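(* Let $b>0$ and let $f\in C^2[-b,b]$ be complex-valued with $f(x)\ne0$ on $[-b,b]$ and $f(0)=1$. Let $\mathbf{V}_1=T_f\mathcal{R}+\mathbf{j}T_{1/f}\mathcal{I}$ and $\mathbf{V}_2=T_{1/f}\mathcal{R}+\mathbf{j}T_f\mathcal{I}$. Then for any $z=x+t\mathbf{j}$ with $(x,t)\in\overline{\mathbf{R}}=[-b,b]\times[-b,b]$, any integer $n\ge0$ and any $a\in\mathbb{B}$, $$\mathbf{V}_1[az^n]=Z^{(n)}(a,0;z)\qquad\text{and}\qquad\mathbf{V}_2[az^n]=Z_1^{(n)}(a,0;z).$$
   Context: $\mathbb{B}=\{w=u+v\mathbf{j}:u,v\in\mathbb{C}\}$ is the commutative algebra of bicomplex numbers, $\mathbf{j}^2=1$, the complex unit commuting with $\mathbf{j}$; $\mathcal{R}(w)=u$, $\mathcal{I}(w)=v$; $z=x+t\mathbf{j}$ with $x,t\in\mathbb{R}$. Operators. For a complex-valued $q\in C[-b,b]$ and $h\in\mathbb{C}$, let $\mathbf{H}(u,v;h)$ be the unique solution, on $\{|u|\le b,|v|\le b,|u+v|\le b\}$, of $$\frac{\partial^2\mathbf{H}}{\partial u\,\partial v}=q(u+v)\mathbf{H},\qquad \mathbf{H}(u,0;h)=\frac h2+\frac12\int_0^uq(s)\,ds,\qquad \mathbf{H}(0,v;h)=\frac h2,$$ $\mathbf{K}(x,t;h)=\mathbf{H}(\frac{x+t}2,\frac{x-t}2;h)$ and $\mathbf{T}_hg(x)=g(x)+\int_{-x}^x\mathbf{K}(x,s;h)g(s)\,ds$.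 $T_f$ is $\mathbf{T}_h$ for $q=q_f:=f''/f$, $h=f'(0)$; $T_{1/f}$ is $\mathbf{T}_h$ for $q=q_{1/f}:=-q_f+2(f'/f)^2$, $h=-f'(0)$. On functions of $(x,t)$ they act in the variable $x$ for each fixed $t$. Formal powers. Set $X^{(0)}\equiv\widetilde X^{(0)}\equiv1$ and, for $n\ge1$, $$X^{(n)}(x)=n\int_0^xX^{(n-1)}(s)\bigl(f^2(s)\bigr)^{(-1)^n}ds,\qquad \widetilde X^{(n)}(x)=n\int_0^x\widetilde X^{(n-1)}(s)\bigl(f^2(s)\bigr)^{(-1)^{n-1}}ds.$$ For $a=a'+\mathbf{j}a''$ ($a',a''\in\mathbb{C}$), $$Z^{(n)}(a,0;z)=f(x)\,\mathcal{R}\bigl({}_*Z^{(n)}(a,0;z)\bigr)+\frac{\mathbf{j}}{f(x)}\,\mathcal{I}\bigl({}_*Z^{(n)}(a,0;z)\bigr),$$ where $${}_*Z^{(n)}(a,0;z)=a'\sum_{k=0}^n\binom nkX^{(n-k)}\mathbf{j}^kt^k+\mathbf{j}a''\sum_{k=0}^n\binom nk\widetilde X^{(n-k)}\mathbf{j}^kt^k\quad(n\text{ odd}),$$ $${}_*Z^{(n)}(a,0;z)=a'\sum_{k=0}^n\binom nk\widetilde X^{(n-k)}\mathbf{j}^kt^k+\mathbf{j}a''\sum_{k=0}^n\binom nkX^{(n-k)}\mathbf{j}^kt^k\quad(n\text{ even}).$$ $Z_1^{(n)}(a,0;z)$ (the formal powers for the successor Vekua equation, in which $f$ is replaced by $1/f$)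 is given by the same formulas with $f$ replaced by $1/f$ everywhere (which interchanges $X^{(n)}$ and $\widetilde X^{(n)}$). *)

(* Defs.v *)
From Stdlib Require Import Reals Lra Arith ClassicalEpsilon.
From Coquelicot Require Export Coquelicot.

Open Scope R_scope.

Record Bicomplex : Type := mkB { scB : C; vecB : C }.

Definition Bplus (w z : Bicomplex) : Bicomplex :=
  mkB (scB w + scB z)%C (vecB w + vecB z)%C.
Definition Bopp (w : Bicomplex) : Bicomplex := mkB (- scB w)%C (- vecB w)%C.
Definition Bmult (w z : Bicomplex) : Bicomplex :=
  mkB (scB w * scB z + vecB w * vecB z)%C (scB w * vecB z + vecB w * scB z)%C.
Definition BofC (c : C) : Bicomplex := mkB c 0%C.
Definition jB : Bicomplex := mkB 0%C 1%C.

Lemma Bicomplex_eq (w z : Bicomplex) :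
  scB w = scB z -> vecB w = vecB z -> w = z.
Proof. destruct w, z; simpl; intros -> ->; reflexivity. Qed.

Lemma jB_sqr : Bmult jB jB = BofC 1.
Proof. apply Bicomplex_eq; simpl; ring. Qed.

Lemma Bmult_comm (w z : Bicomplex) : Bmult w z = Bmult z w.
Proof. apply Bicomplex_eq; simpl; ring. Qed.

Lemma Bicomplex_decomp (w : Bicomplex) :
  w = Bplus (BofC (scB w)) (Bmult (BofC (vecB w)) jB).
Proof. apply Bicomplex_eq; simpl; ring. Qed.

Definition B_AbelianMonoid_mixin : AbelianMonoid.mixin_of Bicomplex.
Proof.
apply (AbelianMonoid.Mixin Bicomplex Bplus (BofC 0));
  intros; apply Bicomplex_eq; simpl; ring.
Defined.

Canonical B_AbelianMonoid :=
  AbelianMonoid.Pack Bicomplex B_AbelianMonoid_mixin Bicomplex.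

Definition B_AbelianGroup_mixin : AbelianGroup.mixin_of B_AbelianMonoid.
Proof.
apply (AbelianGroup.Mixin B_AbelianMonoid Bopp);
  intros; apply Bicomplex_eq; simpl; ring.
Defined.

Canonical B_AbelianGroup :=
  AbelianGroup.Pack Bicomplex
    (AbelianGroup.Class _ B_AbelianMonoid_mixin B_AbelianGroup_mixin) Bicomplex.

Definition B_Ring_mixin : Ring.mixin_of B_AbelianGroup.
Proof.
apply (Ring.Mixin B_AbelianGroup Bmult (BofC 1));
  intros; apply Bicomplex_eq; simpl; ring.
Defined.

Canonical B_Ring :=
  Ring.Pack Bicomplex (Ring.Class _ _ B_Ring_mixin) Bicomplex.

Definition zB (x t : R) : Bicomplex := mkB (RtoC x) (RtoC t).

(** [l] is the derivative of [g] at [x] relative to [D]: one-sided at an end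
    point of an interval [D], and the usual derivative at interior points. *)
Definition is_derive_in (D : R -> Prop) (g : R -> C) (x : R) (l : C) : Prop :=
  filterdiff (K := R_AbsRing) (U := R_NormedModule) (V := C_R_NormedModule)
    g (within D (locally x)) (fun y : R => scal y (l : C_R_NormedModule)).

Definition CInt (g : R -> C) (a b : R) : C :=
  RInt (V := C_R_CompleteNormedModule) g a b.

Definition seg (b x : R) : Prop := - b <= x <= b.

(** Throughout, [f1] and [f2] stand for the derivatives [f'] and [f''] of [f] on
    [-b,b]; this predicate determines their values there. *)
Definition is_C2_on_seg (b : R) (f f1 f2 : R -> C) : Prop :=
  (forall x, seg b x -> is_derive_in (seg b) f x (f1 x)) /\
  (forall x, seg b x -> is_derive_in (seg b) f1 x (f2 x)) /\
  continuous_on (T := R_UniformSpace) (U := C_UniformSpace) (seg b) f2.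

Definition hexagon (b u v : R) : Prop :=
  Rabs u <= b /\ Rabs v <= b /\ Rabs (u + v) <= b.

(** Classical solutions.  Only continuity of [H] and the derivatives occurring
    in the equation are required: this already makes the solution unique on the
    hexagon. *)
Definition is_goursat_solution (b : R) (q : R -> C) (h : C) (H : R -> R -> C)
  : Prop :=
  continuous_on (T := prod_UniformSpace R_UniformSpace R_UniformSpace)
    (U := C_UniformSpace)
    (fun p => hexagon b (fst p) (snd p)) (fun p => H (fst p) (snd p)) /\
  (exists Hv : R -> R -> C,
     (forall u v, hexagon b u v ->
        is_derive_in (fun v' => hexagon b u v') (fun v' => H u v') v (Hv u v)) /\
     (forall u v, hexagon b u v ->
        is_derive_in (fun u' => hexagon b u' v) (fun u' => Hv u' v) u
          (Cmult (q (u + v)) (H u v)))) /\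
  (forall u, Rabs u <= b -> H u 0 = (h / 2 + / 2 * CInt q 0 u)%C) /\
  (forall v, Rabs v <= b -> H 0 v = (h / 2)%C).

(** The solution of the Goursat problem; its values outside the hexagon are
    arbitrary and are never used below. *)
Definition goursat (b : R) (q : R -> C) (h : C) : R -> R -> C :=
  epsilon (inhabits (fun _ _ : R => RtoC 0)) (is_goursat_solution b q h).

Definition kernelK (b : R) (q : R -> C) (h : C) (x t : R) : C :=
  goursat b q h ((x + t) / 2) ((x - t) / 2).

Definition opT (b : R) (q : R -> C) (h : C) (g : R -> C) (x : R) : C :=
  (g x + CInt (fun s => kernelK b q h x s * g s) (- x) x)%C.

Definition q_f (f f2 : R -> C) (x : R) : C := (f2 x / f x)%C.

Definition q_inv (f f1 f2 : R -> C) (x : R) : C :=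
  (- q_f f f2 x + 2 * Cpow (f1 x / f x) 2)%C.

Definition T_f (b : R) (f f1 f2 : R -> C) : (R -> C) -> R -> C :=
  opT b (q_f f f2) (f1 0).

Definition T_inv (b : R) (f f1 f2 : R -> C) : (R -> C) -> R -> C :=
  opT b (q_inv f f1 f2) (- f1 0)%C.

Definition V1 (b : R) (f f1 f2 : R -> C) (w : R -> R -> Bicomplex) (x t : R)
  : Bicomplex :=
  plus (BofC (T_f b f f1 f2 (fun y => scB (w y t)) x))
       (mult jB (BofC (T_inv b f f1 f2 (fun y => vecB (w y t)) x))).

Definition V2 (b : R) (f f1 f2 : R -> C) (w : R -> R -> Bicomplex) (x t : R)
  : Bicomplex :=
  plus (BofC (T_inv b f f1 f2 (fun y => scB (w y t)) x))
       (mult jB (BofC (T_f b f f1 f2 (fun y => vecB (w y t)) x))).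

Definition alt_pow (w : C) (n : nat) : C := if Nat.even n then w else (/ w)%C.

Fixpoint Xpow (f : R -> C) (n : nat) (x : R) : C :=
  match n with
  | O => RtoC 1
  | S m => (RtoC (INR n) *
            CInt (fun s => Xpow f m s * alt_pow (Cpow (f s) 2) n) 0 x)%C
  end.

Fixpoint Xtpow (f : R -> C) (n : nat) (x : R) : C :=
  match n with
  | O => RtoC 1
  | S m => (RtoC (INR n) *
            CInt (fun s => Xtpow f m s * alt_pow (Cpow (f s) 2) m) 0 x)%C
  end.

Definition binomial_sum (Y : nat -> R -> C) (n : nat) (x t : R) : Bicomplex :=
  sum_n (fun k : nat =>
    mult (BofC (RtoC (Binomial.C n k) * Y (n - k)%nat x)%C)
         (mult (pow_n jB k) (BofC (RtoC (t ^ k))))) n.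

Definition Zstar (f : R -> C) (n : nat) (a : Bicomplex) (x t : R) : Bicomplex :=
  let X := binomial_sum (Xpow f) n x t in
  let Xt := binomial_sum (Xtpow f) n x t in
  if Nat.odd n
  then plus (mult (BofC (scB a)) X) (mult (mult jB (BofC (vecB a))) Xt)
  else plus (mult (BofC (scB a)) Xt) (mult (mult jB (BofC (vecB a))) X).

Definition Zpow (f : R -> C) (n : nat) (a : Bicomplex) (x t : R) : Bicomplex :=
  plus (BofC (f x * scB (Zstar f n a x t))%C)
       (mult jB (BofC (/ f x * vecB (Zstar f n a x t))%C)).

Definition Z1pow (f : R -> C) : nat -> Bicomplex -> R -> R -> Bicomplex :=
  Zpow (fun x => / f x)%C.

(* Main.v *)
Require Import Defs.
From Stdlib Require Import Reals Lra Lia ClassicalEpsilon.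
From Coquelicot Require Import Coquelicot.

Open Scope R_scope.

(** Write [phi_n] for [T_f[x^n]].  Everything rests on
    [phi_n = f X^(n)] ([n] odd) and [phi_n = f Xtilde^(n)] ([n] even).
    Granted this, and the same for [1/f], the formula for [V1] and [V2] is the
    binomial expansion of [(x + t j)^n]: an even power of [j] keeps a coefficient in
    the scalar part, where [T_f] (resp. [T_{1/f}]) acts, an odd one moves it to the
    vector part, and the parity of [n - k] decides between [X] and [Xtilde]
    ([Zstar_components], [Zpow_of_operators]).

    To identify [phi_n], one shows first that [T = T_h] intertwines [d^2/dx^2] with
    [d^2/dx^2 - q]: [(T g)'' = q T g + T (g'')], with [T g (0) = g 0] and
    [(T g)' (0) = g' 0 + h g 0] ([opT_ode]).  As [q] is only continuous, the kernel
    is only of class [C^1] and one cannot differentiate it twice.  In characteristic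
    coordinates [T g (x) = g x + 2 * int_0^x G (u, x - u) g (2 u - x) du], and
    [G = g0 (u) + int_0^v A (u, r) dr] with [A (u, v) = int_0^u W (s, v) ds],
    [W = q (u + v) G].  The first differentiation in [x] produces [A = G_v], which
    has no derivative in [v]; but the reflection [u <-> x - u] puts [x] into the other
    slot, where the second differentiation meets [A_u = W]
    ([antidiag_second_derivative]).

    Then the Wronskian [w = f phi_n' - f' phi_n] satisfies
    [w' = n (n - 1) f phi_{n-2}], and [(phi_n / f)' = w / f^2].  Since [f] itself is
    the solution with initial slope [h], the initial values are those of the formal
    powers and two integrations reproduce their recursion ([transmute_powers]).

    The kernel is an arbitrary solution of the Goursat problem, picked by a choice
    operator.  A solution exists by Picard iteration, a contraction for a weighted
    norm ([volterra_solution], [goursat_exists]); and every solution satisfies the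
    integral equation above ([goursat_solution_integral]), which is all that the
    computation uses.  To avoid one-sided derivatives, [q] and the
    solution are extended continuously to the line and the plane by retraction, and
    [f] along its end tangents, so that all derivatives taken at points of
    [[-b, b]] are two-sided. *)

(** * Calculus of complex-valued functions of a real variable *)

Lemma continuous_C_iff {T : UniformSpace} (g : T -> C) (x : T) :
  continuous (U := C_UniformSpace) g x <->
  continuous (fun y => fst (g y)) x /\ continuous (fun y => snd (g y)) x.
Proof.
split.
- intros H; split.
  + apply (continuous_comp (V := C_UniformSpace) g fst x H).
    destruct (g x); apply (continuous_fst (U := R_UniformSpace) (V := R_UniformSpace)).
  + apply (continuous_comp (V := C_UniformSpace) g snd x H).
    destruct (g x); apply (continuous_snd (U := R_UniformSpace) (V := R_UniformSpace)).
- intros [H1 H2].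
  apply (continuous_ext (U := C_UniformSpace) (fun y => (fst (g y), snd (g y)))).
  { intros y; now destruct (g y). }
  apply filterlim_locally; intros eps.
  apply filterlim_locally with (eps := eps) in H1.
  apply filterlim_locally with (eps := eps) in H2.
  generalize (filter_and _ _ H1 H2); apply filter_imp.
  intros y [K1 K2]; now split.
Qed.

Lemma continuous_Cplus {T : UniformSpace} (g h : T -> C) (x : T) :
  continuous (U := C_UniformSpace) g x -> continuous (U := C_UniformSpace) h x ->
  continuous (U := C_UniformSpace) (fun y => g y + h y)%C x.
Proof.
rewrite !continuous_C_iff; intros [g1 g2] [h1 h2]; split; simpl.
- exact (continuous_plus (V := R_NormedModule) _ _ x g1 h1).
- exact (continuous_plus (V := R_NormedModule) _ _ x g2 h2).
Qed.

Lemma continuous_Cmult {T : UniformSpace} (g h : T -> C) (x : T) :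
  continuous (U := C_UniformSpace) g x -> continuous (U := C_UniformSpace) h x ->
  continuous (U := C_UniformSpace) (fun y => g y * h y)%C x.
Proof.
rewrite !continuous_C_iff; intros [g1 g2] [h1 h2]; split; simpl.
- apply (continuous_minus (V := R_NormedModule));
    now apply (continuous_mult (K := R_AbsRing)).
- apply (continuous_plus (V := R_NormedModule));
    now apply (continuous_mult (K := R_AbsRing)).
Qed.

Lemma Csqnorm_neq0 (c : C) : c <> RtoC 0 -> fst c ^ 2 + snd c ^ 2 <> 0.
Proof.
intros Hc E; apply Hc; destruct c as [p q]; simpl in E.
unfold RtoC; f_equal; nra.
Qed.

Lemma continuous_Cinv {T : UniformSpace} (g : T -> C) (x : T) :
  g x <> RtoC 0 -> continuous (U := C_UniformSpace) g x ->
  continuous (U := C_UniformSpace) (fun y => / g y)%C x.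
Proof.
rewrite !continuous_C_iff; intros Hg [g1 g2].
assert (Hn : fst (g x) ^ 2 + snd (g x) ^ 2 <> 0).
{ now apply Csqnorm_neq0. }
assert (Hc : continuous (fun y => / (fst (g y) ^ 2 + snd (g y) ^ 2)) x).
{ apply (continuous_comp (V := R_UniformSpace) (W := R_UniformSpace) _ Rinv);
    [|now apply continuous_Rinv].
  assert (Hsq : forall k : T -> R, continuous k x -> continuous (fun y => k y ^ 2) x).
  { intros k Hk; apply (continuous_comp (V := R_UniformSpace) (W := R_UniformSpace)
      k (fun r => r ^ 2) x Hk).
    apply (ex_derive_continuous (V := R_NormedModule)); auto_derive; trivial. }
  exact (continuous_plus (V := R_NormedModule) _ _ x (Hsq _ g1) (Hsq _ g2)). }
split; simpl; unfold Rdiv; apply (continuous_mult (K := R_AbsRing)); trivial.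
now apply (continuous_opp (V := R_NormedModule)).
Qed.

Lemma continuous_RtoC {T : UniformSpace} (g : T -> R) (x : T) :
  continuous g x -> continuous (U := C_UniformSpace) (fun y => RtoC (g y)) x.
Proof.
intros H; apply continuous_C_iff; split; simpl; trivial; apply continuous_const.
Qed.

Definition is_derive_C (g : R -> C) (x : R) (l : C) : Prop :=
  is_derive (K := R_AbsRing) (V := C_R_NormedModule) g x l.

Lemma is_derive_C_iff (g : R -> C) (x : R) (l : C) :
  is_derive_C g x l <->
  is_derive (fun y => fst (g y)) x (fst l) /\
  is_derive (fun y => snd (g y)) x (snd l).
Proof.
split.
- intros H; split.
  + apply (filterdiff_ext_lin _ (fun y : R => fst (scal y (l : C_R_NormedModule)))).
    * exact (filterdiff_comp' (V := C_R_NormedModule) g fst x _ fst H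
       (filterdiff_linear fst (is_linear_fst (K := R_AbsRing)
          (U := R_NormedModule) (V := R_NormedModule)))).
    * intros y; reflexivity.
  + apply (filterdiff_ext_lin _ (fun y : R => snd (scal y (l : C_R_NormedModule)))).
    * exact (filterdiff_comp' (V := C_R_NormedModule) g snd x _ snd H
       (filterdiff_linear snd (is_linear_snd (K := R_AbsRing)
          (U := R_NormedModule) (V := R_NormedModule)))).
    * intros y; reflexivity.
- intros [H1 H2].
  apply (filterdiff_ext (V := C_R_NormedModule) (fun y => (fst (g y), snd (g y)))).
  { intros y; now destruct (g y). }
  apply (filterdiff_ext_lin (V := C_R_NormedModule) _
     (fun y : R => (scal y (fst l), scal y (snd l)))).
  2: { intros y; now destruct l. }
  apply (filterdiff_comp'_2 (T := R_NormedModule) (U := R_NormedModule)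
    (V := R_NormedModule) (W := C_R_NormedModule)
    (fun y => fst (g y)) (fun y => snd (g y)) (fun p q => (p, q)) x
    (fun y => scal y (fst l)) (fun y => scal y (snd l)) (fun p q => (p, q)) H1 H2).
  apply (filterdiff_linear (V := C_R_NormedModule)).
  apply (is_linear_prod (U := R_NormedModule) (V := R_NormedModule));
    [apply is_linear_fst | apply is_linear_snd].
Qed.

Lemma is_derive_eq_l (f : R -> R) (x l l' : R) :
  is_derive f x l -> l = l' -> is_derive f x l'.
Proof. now intros H <-. Qed.

Lemma is_derive_Cplus (g h : R -> C) (x : R) (g' h' : C) :
  is_derive_C g x g' -> is_derive_C h x h' ->
  is_derive_C (fun y => g y + h y)%C x (g' + h')%C.
Proof. exact (is_derive_plus (V := C_R_NormedModule) g h x g' h'). Qed.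

Lemma is_derive_Cminus (g h : R -> C) (x : R) (g' h' : C) :
  is_derive_C g x g' -> is_derive_C h x h' ->
  is_derive_C (fun y => g y - h y)%C x (g' - h')%C.
Proof. exact (is_derive_minus (V := C_R_NormedModule) g h x g' h'). Qed.

Lemma is_derive_Cmult (g h : R -> C) (x : R) (g' h' : C) :
  is_derive_C g x g' -> is_derive_C h x h' ->
  is_derive_C (fun y => g y * h y)%C x (g' * h x + g x * h')%C.
Proof.
rewrite !is_derive_C_iff; intros [g1 g2] [h1 h2]; split; simpl.
- refine (is_derive_eq_l _ _ _ _ (is_derive_minus (V := R_NormedModule) _ _ _ _ _
    (is_derive_mult _ _ _ _ _ g1 h1 Rmult_comm)
    (is_derive_mult _ _ _ _ _ g2 h2 Rmult_comm)) _).
  unfold minus, plus, mult, opp; simpl; ring.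
- refine (is_derive_eq_l _ _ _ _ (is_derive_plus (V := R_NormedModule) _ _ _ _ _
    (is_derive_mult _ _ _ _ _ g1 h2 Rmult_comm)
    (is_derive_mult _ _ _ _ _ g2 h1 Rmult_comm)) _).
  unfold minus, plus, mult, opp; simpl; ring.
Qed.

Lemma is_derive_Cinv (g : R -> C) (x : R) (g' : C) :
  g x <> RtoC 0 -> is_derive_C g x g' ->
  is_derive_C (fun y => / g y)%C x (- g' / (g x * g x))%C.
Proof.
intros Hx; rewrite !is_derive_C_iff; intros [g1 g2].
apply Csqnorm_neq0 in Hx.
assert (Hn : is_derive (fun y => fst (g y) ^ 2 + snd (g y) ^ 2) x
   (2 * fst (g x) * fst g' + 2 * snd (g x) * snd g')).
{ refine (is_derive_eq_l _ _ _ _ (is_derive_plus (V := R_NormedModule) _ _ _ _ _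
    (is_derive_pow _ 2 _ _ g1) (is_derive_pow _ 2 _ _ g2)) _).
  unfold plus; simpl; ring. }
assert (Hx' : (fst (g x) * fst (g x) - snd (g x) * snd (g x)) ^ 2 +
  (fst (g x) * snd (g x) + snd (g x) * fst (g x)) ^ 2 <> 0).
{ replace (_ + _) with ((fst (g x) ^ 2 + snd (g x) ^ 2) ^ 2) by ring.
  now apply pow_nonzero. }
split; simpl.
- refine (is_derive_eq_l _ _ _ _ (is_derive_div _ _ _ _ _ g1 Hn Hx) _).
  simpl; field; split;
    [intros E; apply Hx'; rewrite <- E; ring | intros E; apply Hx; rewrite <- E; ring].
- refine (is_derive_eq_l _ _ _ _ (is_derive_div _ _ _ _ _
    (is_derive_opp (V := R_NormedModule) _ _ _ g2) Hn Hx) _).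
  unfold opp; simpl; field; split;
    [intros E; apply Hx'; rewrite <- E; ring | intros E; apply Hx; rewrite <- E; ring].
Qed.

Lemma is_derive_RtoC (g : R -> R) (x g' : R) :
  is_derive g x g' -> is_derive_C (fun y => RtoC (g y)) x (RtoC g').
Proof.
intros H; apply is_derive_C_iff; split; simpl; [exact H|].
apply (is_derive_const (V := R_NormedModule)).
Qed.

Lemma is_derive_C_continuous (g : R -> C) (x : R) (l : C) :
  is_derive_C g x l -> continuous (U := C_UniformSpace) g x.
Proof.
intros H; apply (ex_derive_continuous (V := C_R_NormedModule)); now exists l.
Qed.

Lemma ex_CInt_continuous (g : R -> C) (a b : R) :
  (forall x, Rmin a b <= x <= Rmax a b -> continuous (U := C_UniformSpace) g x) ->
  ex_RInt (V := C_R_NormedModule) g a b.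
Proof. exact (ex_RInt_continuous (V := C_R_CompleteNormedModule) g a b). Qed.

Lemma CInt_components (g : R -> C) (a b : R) :
  ex_RInt (V := C_R_NormedModule) g a b ->
  CInt g a b = (RInt (fun x => fst (g x)) a b, RInt (fun x => snd (g x)) a b).
Proof.
intros [l Hl]; unfold CInt.
rewrite (is_RInt_unique (V := C_R_CompleteNormedModule) g a b l Hl).
destruct l as [p q]; apply injective_projections; simpl; symmetry;
  apply is_RInt_unique.
- exact (is_RInt_fct_extend_fst (U := R_NormedModule) (V := R_NormedModule)
    g a b (p, q) Hl).
- exact (is_RInt_fct_extend_snd (U := R_NormedModule) (V := R_NormedModule)
    g a b (p, q) Hl).
Qed.

Lemma CInt_ext (g h : R -> C) (a b : R) :
  (forall x, Rmin a b < x < Rmax a b -> g x = h x) -> CInt g a b = CInt h a b.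
Proof. exact (RInt_ext (V := C_R_CompleteNormedModule) g h a b). Qed.

Lemma CInt_point (g : R -> C) (a : R) : CInt g a a = RtoC 0.
Proof. exact (RInt_point (V := C_R_CompleteNormedModule) a g). Qed.

Lemma CInt_zero (g : R -> C) (a b : R) :
  (forall x, Rmin a b < x < Rmax a b -> g x = RtoC 0) -> CInt g a b = RtoC 0.
Proof.
intros Hg; rewrite (CInt_ext _ _ _ _ Hg); unfold CInt.
rewrite (RInt_const (V := C_R_CompleteNormedModule)).
exact (scal_zero_r (V := C_R_NormedModule) _).
Qed.

Lemma CInt_plus (g h : R -> C) (a b : R) :
  ex_RInt (V := C_R_NormedModule) g a b ->
  ex_RInt (V := C_R_NormedModule) h a b ->
  CInt (fun x => g x + h x)%C a b = (CInt g a b + CInt h a b)%C.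
Proof. exact (RInt_plus (V := C_R_CompleteNormedModule) g h a b). Qed.

Lemma is_CInt_Cmult_l (c : C) (g : R -> C) (a b : R) (l : C) :
  is_RInt (V := C_R_NormedModule) g a b l ->
  is_RInt (V := C_R_NormedModule) (fun x => c * g x)%C a b (c * l)%C.
Proof.
intros H.
pose proof (is_RInt_fct_extend_fst (U := R_NormedModule) (V := R_NormedModule)
  g a b l H) as H1.
pose proof (is_RInt_fct_extend_snd (U := R_NormedModule) (V := R_NormedModule)
  g a b l H) as H2.
apply (is_RInt_fct_extend_pair (U := R_NormedModule) (V := R_NormedModule)).
- exact (is_RInt_minus (V := R_NormedModule) _ _ a b _ _
    (is_RInt_scal _ _ _ (fst c) _ H1) (is_RInt_scal _ _ _ (snd c) _ H2)).
- exact (is_RInt_plus (V := R_NormedModule) _ _ a b _ _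
    (is_RInt_scal _ _ _ (fst c) _ H2) (is_RInt_scal _ _ _ (snd c) _ H1)).
Qed.

Lemma CInt_Cmult_l (c : C) (g : R -> C) (a b : R) :
  ex_RInt (V := C_R_NormedModule) g a b ->
  CInt (fun x => c * g x)%C a b = (c * CInt g a b)%C.
Proof.
intros Hg; apply (is_RInt_unique (V := C_R_CompleteNormedModule)).
apply is_CInt_Cmult_l, (RInt_correct (V := C_R_CompleteNormedModule)), Hg.
Qed.

Lemma CInt_derive (F F' : R -> C) (a b : R) :
  (forall x, Rmin a b <= x <= Rmax a b -> is_derive_C F x (F' x)) ->
  (forall x, Rmin a b <= x <= Rmax a b -> continuous (U := C_UniformSpace) F' x) ->
  CInt F' a b = (F b - F a)%C.
Proof.
intros H1 H2; apply (is_RInt_unique (V := C_R_CompleteNormedModule)).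
exact (is_RInt_derive (V := C_R_CompleteNormedModule) F F' a b H1 H2).
Qed.

Lemma is_derive_CInt (g : R -> C) (a x : R) :
  (forall y, continuous (U := C_UniformSpace) g y) ->
  is_derive_C (fun y => CInt g a y) x (g x).
Proof.
intros Hg; apply (is_derive_RInt (V := C_R_NormedModule) g _ a x); [|apply Hg].
apply filter_forall; intros y.
apply (RInt_correct (V := C_R_CompleteNormedModule)).
apply ex_CInt_continuous; intros z _; apply Hg.
Qed.

Lemma Cmod_CInt_le (g : R -> C) (a b M : R) :
  (forall x, Rmin a b <= x <= Rmax a b -> continuous (U := C_UniformSpace) g x) ->
  (forall x, Rmin a b <= x <= Rmax a b -> Cmod (g x) <= M) ->
  Cmod (CInt g a b) <= Rabs (b - a) * M.
Proof.
assert (K : forall a b, a <= b ->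
  (forall x, a <= x <= b -> continuous (U := C_UniformSpace) g x) ->
  (forall x, a <= x <= b -> Cmod (g x) <= M) ->
  Cmod (CInt g a b) <= (b - a) * M).
{ clear a b; intros a b Hab Hc HM.
  rewrite Cmod_norm.
  apply (norm_RInt_le_const (V := C_R_NormedModule) g a b _ M Hab).
  { intros x Hx; rewrite <- Cmod_norm; now apply HM. }
  apply (RInt_correct (V := C_R_CompleteNormedModule)).
  apply ex_CInt_continuous; rewrite Rmin_left, Rmax_right by trivial; exact Hc. }
intros Hc HM; destruct (Rle_dec a b) as [Hab|Hab].
- rewrite Rmin_left, Rmax_right in * by trivial.
  rewrite Rabs_pos_eq by lra; now apply K.
- assert (Hba : b <= a) by lra.
  rewrite Rmin_right, Rmax_left in * by trivial.
  replace (CInt g a b) with (- CInt g b a)%C.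
  2: { refine (opp_RInt_swap (V := C_R_CompleteNormedModule) g b a _).
       apply ex_CInt_continuous; rewrite Rmin_left, Rmax_right by trivial; exact Hc. }
  rewrite Cmod_opp, Rabs_minus_sym, Rabs_pos_eq by lra; now apply K.
Qed.

Lemma CInt_comp_lin (g : R -> C) (k v a b : R) :
  (forall x, continuous (U := C_UniformSpace) g x) ->
  Cmult (RtoC k) (CInt (fun y => g (k * y + v)) a b)
  = CInt g (k * a + v) (k * b + v).
Proof.
intros Hg.
unfold CInt at 2; rewrite <- (RInt_comp_lin (V := C_R_CompleteNormedModule) g k v a b).
2: { apply ex_CInt_continuous; intros; apply Hg. }
rewrite <- CInt_Cmult_l.
2: { apply ex_CInt_continuous; intros x _.
     apply (continuous_comp (V := R_UniformSpace) (fun y => k * y + v) g); [|apply Hg].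
     apply (continuous_plus (V := R_NormedModule)); [|apply continuous_const].
     apply (continuous_mult (K := R_AbsRing)); [apply continuous_const|apply continuous_id]. }
apply CInt_ext; intros x _; symmetry; apply scal_R_Cmult.
Qed.

(** * Derivatives relative to a closed interval *)

Lemma continuous_retract {T U : UniformSpace} (D : T -> Prop) (g : T -> U)
  (p : T -> T) (x : T) :
  (forall y, D (p y)) -> continuous p x -> continuous_on D g ->
  continuous (fun y => g (p y)) x.
Proof.
intros HD Hp Hg.
apply (filterlim_comp _ _ _ p g _ (within D (locally (p x))));
  [|exact (Hg _ (HD x))].
intros P HP; generalize (Hp _ HP); unfold filtermap; apply filter_imp.
intros y Hy; exact (Hy (HD y)).
Qed.

Definition clamp (lo hi x : R) : R := Rmax lo (Rmin hi x).

Lemma clamp_in (lo hi x : R) : lo <= hi -> lo <= clamp lo hi x <= hi.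
Proof.
intros H; unfold clamp; split; [apply Rmax_l|].
apply Rmax_lub; [exact H | apply Rmin_l].
Qed.

Lemma clamp_id (lo hi x : R) : lo <= x <= hi -> clamp lo hi x = x.
Proof.
intros H; unfold clamp; rewrite Rmin_right by lra; now rewrite Rmax_right by lra.
Qed.

Lemma clamp_dist (lo hi x y : R) :
  lo <= x <= hi -> Rabs (clamp lo hi y - x) <= Rabs (y - x) /\
                   Rabs (y - clamp lo hi y) <= Rabs (y - x).
Proof.
intros H; unfold clamp, Rmax, Rmin; destruct (Rle_dec hi y); destruct (Rle_dec lo _);
  unfold Rabs; repeat destruct Rcase_abs; lra.
Qed.

Lemma continuous_Rmin_comp {T : UniformSpace} (g h : T -> R) (x : T) :
  continuous g x -> continuous h x -> continuous (fun y => Rmin (g y) (h y)) x.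
Proof.
intros Hg Hh.
apply (continuous_ext (fun y => (g y + h y - Rabs (g y - h y)) / 2)).
{ intros y; unfold Rmin, Rabs; destruct Rle_dec, Rcase_abs; lra. }
unfold Rdiv; apply (continuous_mult (K := R_AbsRing)); [|apply continuous_const].
apply (continuous_minus (V := R_NormedModule)).
- now apply (continuous_plus (V := R_NormedModule)).
- apply (continuous_comp (V := R_UniformSpace) _ Rabs); [|apply continuous_Rabs].
  now apply (continuous_minus (V := R_NormedModule)).
Qed.

Lemma continuous_Rmax_comp {T : UniformSpace} (g h : T -> R) (x : T) :
  continuous g x -> continuous h x -> continuous (fun y => Rmax (g y) (h y)) x.
Proof.
intros Hg Hh.
apply (continuous_ext (fun y => (g y + h y + Rabs (g y - h y)) / 2)).
{ intros y; unfold Rmax, Rabs; destruct Rle_dec, Rcase_abs; lra. }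
unfold Rdiv; apply (continuous_mult (K := R_AbsRing)); [|apply continuous_const].
apply (continuous_plus (V := R_NormedModule)).
- now apply (continuous_plus (V := R_NormedModule)).
- apply (continuous_comp (V := R_UniformSpace) _ Rabs); [|apply continuous_Rabs].
  now apply (continuous_minus (V := R_NormedModule)).
Qed.

Lemma continuous_clamp {T : UniformSpace} (lo hi g : T -> R) (x : T) :
  continuous lo x -> continuous hi x -> continuous g x ->
  continuous (fun y => clamp (lo y) (hi y) (g y)) x.
Proof.
intros; apply continuous_Rmax_comp; trivial; now apply continuous_Rmin_comp.
Qed.

(** Only the point [x] is a limit of the filter involved, so the Landau condition in
    [filterdiff] reduces to a single estimate. *)
Lemma is_derive_in_bound (D : R -> Prop) (g : R -> C) (x : R) (l : C) :
  is_derive_in D g x l -> D x ->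
  forall eps : posreal, exists delta : posreal, forall y, D y ->
    Rabs (y - x) < delta ->
    Cmod (g y - g x - RtoC (y - x) * l) <= eps * Rabs (y - x).
Proof.
intros [_ H] Dx eps.
assert (Hlim : is_filter_lim (T := R_UniformSpace) (within D (locally x)) x).
{ intros P HP; exact (filter_imp _ _ (fun y Hy _ => Hy) HP). }
destruct (H x Hlim eps) as [delta Hd].
exists delta; intros y Dy Hy.
specialize (Hd y Hy Dy).
rewrite Cmod_norm, <- scal_R_Cmult; exact Hd.
Qed.

Lemma is_derive_C_of_bound (g : R -> C) (x : R) (l : C) :
  (forall eps : posreal, exists delta : posreal, forall y,
    Rabs (y - x) < delta ->
    Cmod (g y - g x - RtoC (y - x) * l) <= eps * Rabs (y - x)) ->
  is_derive_C g x l.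
Proof.
intros H; split; [apply is_linear_scal_l|].
intros x' Hx' eps.
apply (is_filter_lim_locally_unique (K := R_AbsRing) (V := R_NormedModule)) in Hx'.
subst x'; destruct (H eps) as [delta Hd].
exists delta; intros y Hy.
specialize (Hd y Hy).
rewrite Cmod_norm, <- scal_R_Cmult in Hd; exact Hd.
Qed.

(** Continuing [g] past the ends of the interval along its end tangents turns its
    relative derivatives into ordinary two-sided ones. *)
Definition extend_tangent (lo hi : R) (g g' : R -> C) (y : R) : C :=
  let c := clamp lo hi y in (g c + RtoC (y - c) * g' c)%C.

Lemma extend_tangent_id (lo hi : R) (g g' : R -> C) (x : R) :
  lo <= x <= hi -> extend_tangent lo hi g g' x = g x.
Proof.
intros H; unfold extend_tangent; rewrite clamp_id by trivial.
replace (x - x) with 0 by ring; ring.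
Qed.

Lemma continuous_on_bound (D : R -> Prop) (g : R -> C) (x : R) :
  continuous_on (T := R_UniformSpace) (U := C_UniformSpace) D g -> D x ->
  forall eps : posreal, exists delta : posreal, forall y, D y ->
    Rabs (y - x) < delta -> Cmod (g y - g x) <= eps.
Proof.
intros H Dx eps.
pose proof (proj1 (filterlim_locally_ball_norm (U := C_R_NormedModule)
   (F := within D (locally x)) g (g x)) (H x Dx) eps) as [delta Hd].
exists delta; intros y Dy Hy.
rewrite Cmod_norm; apply Rlt_le; exact (Hd y Hy Dy).
Qed.

(** With [c] the clamped point, the increment of the extension at [x] splits into the
    increment of [g] from [x] to [c], controlled by the relative derivative, and a
    tangential part, where [g' c - g' x] is small.  This covers both sides of an end
    point at once. *)
Lemma is_derive_extend_tangent (D : R -> Prop) (lo hi : R) (g g' : R -> C) (x : R) :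
  (forall y, D y <-> lo <= y <= hi) -> D x ->
  is_derive_in D g x (g' x) ->
  continuous_on (T := R_UniformSpace) (U := C_UniformSpace) D g' ->
  is_derive_C (extend_tangent lo hi g g') x (g' x).
Proof.
intros HD Dx Hg Hg'; apply is_derive_C_of_bound; intros eps.
assert (He : 0 < eps / 2) by (destruct eps; simpl; lra).
destruct (is_derive_in_bound _ _ _ _ Hg Dx (mkposreal _ He)) as [d1 H1].
destruct (continuous_on_bound _ _ _ Hg' Dx (mkposreal _ He)) as [d2 H2].
assert (Hd : 0 < Rmin d1 d2) by (apply Rmin_pos; [apply d1 | apply d2]).
exists (mkposreal _ Hd); simpl; intros y Hy; simpl in *.
assert (Hx : lo <= x <= hi) by now apply HD.
rewrite (extend_tangent_id _ _ _ _ x Hx); unfold extend_tangent.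
destruct (clamp_dist lo hi x y Hx) as [K1 K2].
assert (Dc : D (clamp lo hi y)) by (apply HD, clamp_in; lra).
set (c := clamp lo hi y) in *.
pose proof (Rmin_l d1 d2); pose proof (Rmin_r d1 d2).
specialize (H1 c Dc ltac:(lra)); specialize (H2 c Dc ltac:(lra)).
replace (g c + RtoC (y - c) * g' c - g x - RtoC (y - x) * g' x)%C
  with ((g c - g x - RtoC (c - x) * g' x) + RtoC (y - c) * (g' c - g' x))%C
  by (rewrite !RtoC_minus; ring).
eapply Rle_trans; [apply Cmod_triangle|].
rewrite Cmod_mult, Cmod_R.
pose proof (Cmod_ge_0 (g' c - g' x)); pose proof (Rabs_pos (y - c)).
apply Rle_trans with (eps / 2 * Rabs (c - x) + Rabs (y - c) * (eps / 2)); nra.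
Qed.

Lemma continuous_on_clamp (D : R -> Prop) (lo hi : R) (g : R -> C) (x : R) :
  lo <= hi -> (forall y, D y <-> lo <= y <= hi) ->
  continuous_on (T := R_UniformSpace) (U := C_UniformSpace) D g ->
  continuous (U := C_UniformSpace) (fun y => g (clamp lo hi y)) x.
Proof.
intros Hlh HD Hg.
apply (continuous_retract (T := R_UniformSpace) D g (clamp lo hi)).
- intros y; now apply HD, clamp_in.
- apply (continuous_clamp (fun _ => lo) (fun _ => hi) (fun y => y));
    [apply continuous_const | apply continuous_const | apply continuous_id].
- exact Hg.
Qed.

Lemma CInt_derive_in (D : R -> Prop) (lo hi : R) (g g' : R -> C) (x y : R) :
  (forall z, D z <-> lo <= z <= hi) -> D x -> D y ->
  (forall z, D z -> is_derive_in D g z (g' z)) ->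
  continuous_on (T := R_UniformSpace) (U := C_UniformSpace) D g' ->
  CInt g' x y = (g y - g x)%C.
Proof.
intros HD Dx Dy Hg Hg'.
assert (Hx := proj1 (HD x) Dx); assert (Hy := proj1 (HD y) Dy).
assert (Hin : forall z, Rmin x y <= z <= Rmax x y -> lo <= z <= hi).
{ intros z; unfold Rmin, Rmax; destruct (Rle_dec x y); lra. }
rewrite (CInt_ext g' (fun z => g' (clamp lo hi z))).
2: { intros z Hz; rewrite clamp_id; [reflexivity | apply Hin; lra]. }
rewrite (CInt_derive (extend_tangent lo hi g g')).
- now rewrite !extend_tangent_id.
- intros z Hz; apply Hin in Hz; rewrite clamp_id by trivial.
  apply HD in Hz; apply (is_derive_extend_tangent D); trivial; now apply Hg.
- intros z _; apply (continuous_on_clamp D); trivial; lra.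
Qed.

Lemma is_derive_in_continuous_on (D : R -> Prop) (g g' : R -> C) :
  (forall z, D z -> is_derive_in D g z (g' z)) ->
  continuous_on (T := R_UniformSpace) (U := C_UniformSpace) D g.
Proof.
intros Hg x Dx.
apply (filterlim_locally_ball_norm (U := C_R_NormedModule)); intros eps.
destruct (is_derive_in_bound _ _ _ _ (Hg x Dx) Dx (mkposreal 1 Rlt_0_1)) as [d Hd].
simpl in Hd; set (m := Cmod (g' x) + 2).
assert (Hm : 0 < m) by (pose proof (Cmod_ge_0 (g' x)); unfold m; lra).
assert (Hr : 0 < Rmin d (eps / m)).
{ apply Rmin_pos; [apply d | apply Rdiv_lt_0_compat; [apply eps | exact Hm]]. }
exists (mkposreal _ Hr); intros y Hy Dy.
assert (Hy' : Rabs (y - x) < Rmin d (eps / m)) by exact Hy.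
pose proof (Rmin_l d (eps / m)); pose proof (Rmin_r d (eps / m)).
specialize (Hd y Dy ltac:(lra)).
assert (K : Rabs (y - x) * m < eps) by (apply Rlt_div_r; lra).
unfold ball_norm; rewrite <- Cmod_norm; change (minus (g y) (g x)) with (g y - g x)%C.
replace (g y - g x)%C with ((g y - g x - RtoC (y - x) * g' x) + RtoC (y - x) * g' x)%C
  by ring.
eapply Rle_lt_trans; [apply Cmod_triangle|].
rewrite Cmod_mult, Cmod_R; unfold m in K; pose proof (Rabs_pos (y - x)); nra.
Qed.

(** Relative derivatives are unique only because the interval is nondegenerate.  This
    will force [H_v] to vanish on the axis [u = 0], where [H] is constant. *)
Lemma is_derive_in_const (D : R -> Prop) (lo hi : R) (g : R -> C) (c l : C) (x : R) :
  lo < hi -> (forall y, D y <-> lo <= y <= hi) -> D x ->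
  (forall y, D y -> g y = c) -> is_derive_in D g x l -> l = RtoC 0.
Proof.
intros Hlh HD Dx Hc Hg.
assert (Hx := proj1 (HD x) Dx).
apply Cmod_eq_0, Rle_antisym; [|apply Cmod_ge_0].
apply le_epsilon; intros e He.
destruct (is_derive_in_bound _ _ _ _ Hg Dx (mkposreal e He)) as [d Hd].
assert (Hy : exists y, lo <= y <= hi /\ 0 < Rabs (y - x) < d).
{ destruct d as [d d0]; simpl.
  destruct (Rle_dec x ((lo + hi) / 2)) as [H|H].
  - exists (x + Rmin (d / 2) ((hi - lo) / 2)).
    assert (0 < Rmin (d / 2) ((hi - lo) / 2)) by (apply Rmin_pos; lra).
    pose proof (Rmin_l (d / 2) ((hi - lo) / 2)).
    pose proof (Rmin_r (d / 2) ((hi - lo) / 2)).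
    split; [lra|]. rewrite Rabs_pos_eq; lra.
  - exists (x - Rmin (d / 2) ((hi - lo) / 2)).
    assert (0 < Rmin (d / 2) ((hi - lo) / 2)) by (apply Rmin_pos; lra).
    pose proof (Rmin_l (d / 2) ((hi - lo) / 2)).
    pose proof (Rmin_r (d / 2) ((hi - lo) / 2)).
    split; [lra|]. rewrite Rabs_minus_sym, Rabs_pos_eq; lra. }
destruct Hy as [y [Hy [Hy0 Hyd]]].
apply HD in Hy; specialize (Hd y Hy Hyd).
rewrite (Hc y Hy), (Hc x Dx) in Hd.
replace (c - c - RtoC (y - x) * l)%C with (- (RtoC (y - x) * l))%C in Hd by ring.
rewrite Cmod_opp, Cmod_mult, Cmod_R in Hd; simpl in Hd; nra.
Qed.

(** * Integrals depending on a parameter *)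

Definition continuous_2 {U : UniformSpace} (F : R -> R -> U) : Prop :=
  forall p : R * R,
    continuous (T := prod_UniformSpace R_UniformSpace R_UniformSpace)
      (fun p => F (fst p) (snd p)) p.

Notation continuous_2C := (continuous_2 (U := C_UniformSpace)).
Notation continuous_2R := (continuous_2 (U := R_UniformSpace)).

Lemma continuous_2_comp {T U : UniformSpace} (F : R -> R -> U) (g h : T -> R) (x : T) :
  continuous_2 F -> continuous g x -> continuous h x ->
  continuous (fun y => F (g y) (h y)) x.
Proof.
intros HF Hg Hh.
exact (continuous_comp_2 (V := R_UniformSpace) (W := R_UniformSpace)
  g h F x Hg Hh (HF (g x, h x))).
Qed.

Lemma continuous_2_slice_l {U : UniformSpace} (F : R -> R -> U) (v x : R) :
  continuous_2 F -> continuous (fun u => F u v) x.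
Proof.
intros HF; apply (continuous_2_comp (T := R_UniformSpace) F (fun u => u) (fun _ => v));
  [exact HF | apply continuous_id | apply continuous_const].
Qed.

Lemma continuous_2_slice_r {U : UniformSpace} (F : R -> R -> U) (u x : R) :
  continuous_2 F -> continuous (fun v => F u v) x.
Proof.
intros HF; apply (continuous_2_comp (T := R_UniformSpace) F (fun _ => u) (fun v => v));
  [exact HF | apply continuous_const | apply continuous_id].
Qed.

Lemma continuous_2C_components (F : R -> R -> C) :
  continuous_2C F ->
  continuous_2R (fun u v => fst (F u v)) /\ continuous_2R (fun u v => snd (F u v)).
Proof.
now intros HF; split; intros p; specialize (HF p); apply continuous_C_iff in HF.
Qed.

Lemma continuity_2d_pt_2R (F : R -> R -> R) (x y : R) :
  continuous_2R F -> continuity_2d_pt F x y.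
Proof. intros HF; apply continuity_2d_pt_filterlim; exact (HF (x, y)). Qed.

Lemma continuous_2_swap {U : UniformSpace} (F : R -> R -> U) :
  continuous_2 F -> continuous_2 (fun u v => F v u).
Proof.
intros HF [u v].
apply (continuous_2_comp (T := prod_UniformSpace R_UniformSpace R_UniformSpace)
   F snd fst (u, v) HF); [apply continuous_snd | apply continuous_fst].
Qed.

Lemma Leibniz_R (F F' : R -> R -> R) (x : R) :
  (forall u y, is_derive (F u) y (F' u y)) ->
  continuous_2R F -> continuous_2R F' ->
  is_derive (fun y => RInt (fun u => F u y) 0 y) x
    (F x x + RInt (fun u => F' u x) 0 x).
Proof.
intros Hd HF HF'.
assert (Hex : forall y a b, ex_RInt (fun t => F t y) a b).
{ intros y a b; apply (ex_RInt_continuous (V := R_CompleteNormedModule)).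
  intros z _; now apply continuous_2_slice_l. }
assert (HD : forall y t, Derive (fun z => F t z) y = F' t y).
{ intros; now apply is_derive_unique. }
assert (HF2 : forall y t, continuity_2d_pt (fun u v => Derive (fun z => F v z) u) y t).
{ intros y t; apply (continuity_2d_pt_ext (fun u v => F' v u)).
  - intros; symmetry; apply HD.
  - now apply continuity_2d_pt_2R, continuous_2_swap. }
refine (is_derive_eq_l _ _ _ _ (is_derive_RInt_param_bound_comp_aux3
  (fun y t => F t y) 0 (fun y => y) x 1 _ _ _ _ _ _ _) _).
- apply filter_forall; auto.
- exists (mkposreal 1 Rlt_0_1); apply filter_forall; auto.
- apply (is_derive_id (K := R_AbsRing)).
- exists (mkposreal 1 Rlt_0_1); apply filter_forall; intros y t _.
  exists (F' t y); apply Hd.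
- auto.
- exists (mkposreal 1 Rlt_0_1); auto.
- apply continuity_pt_filterlim; now apply continuous_2_slice_l.
- rewrite Rmult_1_r, Rplus_comm; f_equal; apply RInt_ext; auto.
Qed.

Lemma ex_CInt_2C (F : R -> R -> C) (v a b : R) :
  continuous_2C F -> ex_RInt (V := C_R_NormedModule) (fun u => F u v) a b.
Proof.
intros HF; apply ex_CInt_continuous; intros z _; now apply continuous_2_slice_l.
Qed.

Lemma Leibniz_C (F F' : R -> R -> C) (x : R) :
  (forall u y, is_derive_C (F u) y (F' u y)) ->
  continuous_2C F -> continuous_2C F' ->
  is_derive_C (fun y => CInt (fun u => F u y) 0 y) x
    (F x x + CInt (fun u => F' u x) 0 x)%C.
Proof.
intros Hd HF HF'.
destruct (continuous_2C_components F HF) as [F1 F2].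
destruct (continuous_2C_components F' HF') as [F1' F2'].
rewrite CInt_components by now apply ex_CInt_2C.
apply is_derive_C_iff; split.
- apply (is_derive_ext (fun y => RInt (fun u => fst (F u y)) 0 y)).
  { intros y; now rewrite CInt_components by now apply ex_CInt_2C. }
  apply (Leibniz_R (fun u y => fst (F u y)) (fun u y => fst (F' u y))); trivial.
  intros u y; exact (proj1 (proj1 (is_derive_C_iff _ _ _) (Hd u y))).
- apply (is_derive_ext (fun y => RInt (fun u => snd (F u y)) 0 y)).
  { intros y; now rewrite CInt_components by now apply ex_CInt_2C. }
  apply (Leibniz_R (fun u y => snd (F u y)) (fun u y => snd (F' u y))); trivial.
  intros u y; exact (proj2 (proj1 (is_derive_C_iff _ _ _) (Hd u y))).
Qed.

Lemma Cmod_le_components (c : C) : Cmod c <= Rabs (fst c) + Rabs (snd c).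
Proof.
unfold Cmod; rewrite <- (sqrt_Rsqr (Rabs (fst c) + Rabs (snd c))).
2: { pose proof (Rabs_pos (fst c)); pose proof (Rabs_pos (snd c)); lra. }
apply sqrt_le_1_alt; rewrite <- (pow2_abs (fst c)), <- (pow2_abs (snd c)).
unfold Rsqr; pose proof (Rabs_pos (fst c)); pose proof (Rabs_pos (snd c)); nra.
Qed.

Lemma uniform_continuity_2C (F : R -> R -> C) (a b c d : R) (eps : posreal) :
  continuous_2C F ->
  exists delta : posreal, forall x y u v,
    a <= x <= b -> c <= y <= d -> a <= u <= b -> c <= v <= d ->
    Rabs (u - x) < delta -> Rabs (v - y) < delta ->
    Cmod (F u v - F x y) < eps.
Proof.
intros HF; destruct (continuous_2C_components F HF) as [F1 F2].
assert (He : 0 < eps / 2) by (destruct eps; simpl; lra).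
destruct (uniform_continuity_2d _ a b c d
  (fun x y _ _ => continuity_2d_pt_2R _ x y F1) (mkposreal _ He)) as [d1 H1].
destruct (uniform_continuity_2d _ a b c d
  (fun x y _ _ => continuity_2d_pt_2R _ x y F2) (mkposreal _ He)) as [d2 H2].
assert (Hd : 0 < Rmin d1 d2) by (apply Rmin_pos; [apply d1 | apply d2]).
exists (mkposreal _ Hd); simpl; intros x y u v hx hy hu hv Hu Hv.
pose proof (Rmin_l d1 d2); pose proof (Rmin_r d1 d2).
specialize (H1 x y u v hx hy hu hv ltac:(lra) ltac:(lra)).
specialize (H2 x y u v hx hy hu hv ltac:(lra) ltac:(lra)).
eapply Rle_lt_trans; [apply Cmod_le_components|].
change (fst (F u v - F x y)%C) with (fst (F u v) - fst (F x y)).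
change (snd (F u v - F x y)%C) with (snd (F u v) - snd (F x y)).
simpl in H1, H2; lra.
Qed.

Lemma CInt_minus (g h : R -> C) (a b : R) :
  ex_RInt (V := C_R_NormedModule) g a b ->
  ex_RInt (V := C_R_NormedModule) h a b ->
  CInt (fun x => g x - h x)%C a b = (CInt g a b - CInt h a b)%C.
Proof. exact (RInt_minus (V := C_R_CompleteNormedModule) g h a b). Qed.

Lemma continuous_C_of_bound {T : UniformSpace} (g : T -> C) (x : T) :
  (forall eps : posreal, locally x (fun y => Cmod (g y - g x) < eps)) ->
  continuous (U := C_UniformSpace) g x.
Proof.
intros H; apply (filterlim_locally_ball_norm (U := C_R_NormedModule)); intros eps.
generalize (H eps); apply filter_imp; intros y Hy.
unfold ball_norm; now rewrite <- Cmod_norm.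
Qed.

(** Uniform continuity of [F] on a compact rectangle handles the parameter, continuity
    of the primitive of [F (., v0)] the end point. *)
Lemma continuous_2C_CInt (F : R -> R -> C) :
  continuous_2C F -> continuous_2C (fun u v => CInt (fun s => F s v) 0 u).
Proof.
intros HF [u0 v0]; apply continuous_C_of_bound; intros eps.
set (r := Rabs u0 + 1).
assert (Hr : 0 < r) by (unfold r; pose proof (Rabs_pos u0); lra).
assert (He : 0 < eps / (2 * r)) by (apply Rdiv_lt_0_compat; [apply eps | lra]).
destruct (uniform_continuity_2C F (- r) r (v0 - 1) (v0 + 1) (mkposreal _ He) HF)
  as [d Hd]; simpl in Hd.
assert (Hs : continuous (U := C_UniformSpace) (fun u => CInt (fun s => F s v0) 0 u) u0).
{ refine (is_derive_C_continuous _ _ _ (is_derive_CInt (fun s => F s v0) 0 u0 _)).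
  intros y; now apply continuous_2_slice_l. }
assert (He2 : 0 < eps / 2) by (destruct eps; simpl; lra).
apply (filterlim_locally_ball_norm (U := C_R_NormedModule)) with
  (eps := mkposreal _ He2) in Hs.
destruct Hs as [d' Hd'].
assert (Hm : 0 < Rmin 1 (Rmin d d')).
{ repeat apply Rmin_pos; [lra | apply d | apply d']. }
exists (mkposreal _ Hm); intros [u v] [Hu Hv]; simpl in Hu, Hv |- *.
assert (Hu' : Rabs (u - u0) < Rmin 1 (Rmin d d')) by exact Hu.
assert (Hv' : Rabs (v - v0) < Rmin 1 (Rmin d d')) by exact Hv.
pose proof (Rmin_l 1 (Rmin d d')); pose proof (Rmin_r 1 (Rmin d d')).
pose proof (Rmin_l d d'); pose proof (Rmin_r d d').
replace (CInt (fun s => F s v) 0 u - CInt (fun s => F s v0) 0 u0)%C with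
  (CInt (fun s => F s v - F s v0) 0 u
   + (CInt (fun s => F s v0) 0 u - CInt (fun s => F s v0) 0 u0))%C.
2: { rewrite CInt_minus by now apply ex_CInt_2C. ring. }
eapply Rle_lt_trans; [apply Cmod_triangle|].
assert (Hur : Rabs u <= r).
{ unfold r; replace u with (u0 + (u - u0)) by ring.
  eapply Rle_trans; [apply Rabs_triang|]; lra. }
assert (K1 : Cmod (CInt (fun s => F s v - F s v0)%C 0 u) <= eps / 2).
{ eapply Rle_trans; [apply (Cmod_CInt_le _ 0 u (eps / (2 * r)))|].
  - intros s _; apply (continuous_Cplus (fun s => F s v) (fun s => - F s v0)%C).
    + now apply continuous_2_slice_l.
    + apply (continuous_opp (V := C_R_NormedModule)); now apply continuous_2_slice_l.
  - intros s Hs; apply Rlt_le, Hd.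
    + apply Rabs_le_between, Rle_trans with (Rabs u); [|exact Hur].
      unfold Rmin, Rmax in Hs; destruct (Rle_dec 0 u); unfold Rabs;
        repeat destruct Rcase_abs; lra.
    + lra.
    + apply Rabs_le_between, Rle_trans with (Rabs u); [|exact Hur].
      unfold Rmin, Rmax in Hs; destruct (Rle_dec 0 u); unfold Rabs;
        repeat destruct Rcase_abs; lra.
    + assert (-1 < v - v0 < 1) by (apply Rabs_lt_between; lra); lra.
    + rewrite Rminus_diag, Rabs_R0; apply d.
    + lra.
  - rewrite Rminus_0_r.
    apply Rle_trans with (r * (eps / (2 * r))); [|right; field; lra].
    apply Rmult_le_compat_r; lra. }
assert (K2 : Cmod (CInt (fun s => F s v0) 0 u - CInt (fun s => F s v0) 0 u0) < eps / 2).
{ assert (B : ball u0 d' u) by (unfold ball; simpl; unfold AbsRing_ball, abs, minus; simpl;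
     change (Rabs (u - u0) < d'); lra).
  specialize (Hd' u B); unfold ball_norm in Hd'; rewrite <- Cmod_norm in Hd'; exact Hd'. }
lra.
Qed.

(** * Differentiating the integral over an antidiagonal *)

Lemma is_derive_C_comp (g : R -> C) (k : R -> R) (x dk : R) (l : C) :
  is_derive_C g (k x) l -> is_derive k x dk ->
  is_derive_C (fun y => g (k y)) x (RtoC dk * l)%C.
Proof.
intros Hg Hk; rewrite <- scal_R_Cmult.
exact (is_derive_comp (V := C_R_NormedModule) g k x l dk Hg Hk).
Qed.

Lemma is_derive_C_eq (g : R -> C) (x : R) (l l' : C) :
  is_derive_C g x l -> l = l' -> is_derive_C g x l'.
Proof. now intros H <-. Qed.

(** The segment [u + v = x] of the characteristic plane, where [s = u - v] is the
    integration variable of the transmutation operator. *)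
Definition antidiag (N : R -> R -> C) (g : R -> C) (x : R) : C :=
  CInt (fun u => N u (x - u)%R * g (2 * u - x)%R)%C 0 x.

Lemma continuous_antidiag_integrand (N : R -> R -> C) (g : R -> C) :
  continuous_2C N -> (forall s, continuous (U := C_UniformSpace) g s) ->
  continuous_2C (fun u x => N u (x - u)%R * g (2 * u - x)%R)%C.
Proof.
intros HN Hg p.
assert (H1 : continuous (T := prod_UniformSpace R_UniformSpace R_UniformSpace)
  (U := R_UniformSpace) fst p) by (destruct p; apply continuous_fst).
assert (H2 : continuous (T := prod_UniformSpace R_UniformSpace R_UniformSpace)
  (U := R_UniformSpace) snd p) by (destruct p; apply continuous_snd).
apply (continuous_Cmult (fun p => N (fst p) (snd p - fst p)%R)
  (fun p => g (2 * fst p - snd p)%R)).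
- apply (continuous_2_comp (T := prod_UniformSpace R_UniformSpace R_UniformSpace) N
    fst (fun p => snd p - fst p)); trivial.
  now apply (continuous_minus (V := R_NormedModule)).
- apply (continuous_comp (V := R_UniformSpace) (fun p : R * R => 2 * fst p - snd p) g);
    [|apply Hg].
  apply (continuous_minus (V := R_NormedModule)); [|exact H2].
  apply (continuous_mult (K := R_AbsRing)); [apply continuous_const | exact H1].
Qed.

Lemma ex_antidiag (N : R -> R -> C) (g : R -> C) (x : R) :
  continuous_2C N -> (forall s, continuous (U := C_UniformSpace) g s) ->
  ex_RInt (V := C_R_NormedModule) (fun u => N u (x - u)%R * g (2 * u - x)%R)%C 0 x.
Proof.
intros HN Hg.
apply (ex_CInt_2C (fun u x => N u (x - u)%R * g (2 * u - x)%R)%C).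
now apply continuous_antidiag_integrand.
Qed.

Lemma antidiag_derive_r (N Nv : R -> R -> C) (g g' : R -> C) (x : R) :
  continuous_2C N -> continuous_2C Nv ->
  (forall s, continuous (U := C_UniformSpace) g' s) ->
  (forall u v, is_derive_C (N u) v (Nv u v)) ->
  (forall s, is_derive_C g s (g' s)) ->
  is_derive_C (antidiag N g) x
    (N x 0%R * g x + (antidiag Nv g x - antidiag N g' x))%C.
Proof.
intros HN HNv Hg' HdN Hdg.
assert (Hg : forall s, continuous (U := C_UniformSpace) g s).
{ intros s; exact (is_derive_C_continuous _ _ _ (Hdg s)). }
refine (is_derive_C_eq _ _ _ _ (Leibniz_C
  (fun u y => N u (y - u)%R * g (2 * u - y)%R)%C
  (fun u y => Nv u (y - u)%R * g (2 * u - y)%R + - (N u (y - u)%R * g' (2 * u - y)%R))%C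
  x _ _ _) _).
- intros u y.
  assert (D1 : is_derive_C (fun y => N u (y - u)%R) y (Nv u (y - u)%R)).
  { refine (is_derive_C_eq _ _ _ _ (is_derive_C_comp (N u) (fun y => y - u) y 1 _
      (HdN u (y - u)%R) _) _); [auto_derive; trivial; ring | ring]. }
  assert (D2 : is_derive_C (fun y => g (2 * u - y)) y (- g' (2 * u - y)%R)%C).
  { refine (is_derive_C_eq _ _ _ _ (is_derive_C_comp g (fun y => 2 * u - y) y (-1) _
      (Hdg (2 * u - y)) _) _); [auto_derive; trivial; ring |].
    replace (-1) with (Ropp 1) by ring; rewrite RtoC_opp; ring. }
  refine (is_derive_C_eq _ _ _ _ (is_derive_Cmult _ _ _ _ _ D1 D2) _); ring.
- now apply continuous_antidiag_integrand.
- intros p; apply (continuous_Cplus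
   (fun p => Nv (fst p) (snd p - fst p)%R * g (2 * fst p - snd p)%R)%C
   (fun p => - (N (fst p) (snd p - fst p)%R * g' (2 * fst p - snd p)%R))%C).
  + now apply (continuous_antidiag_integrand Nv g).
  + apply (continuous_opp (V := C_R_NormedModule)).
    now apply (continuous_antidiag_integrand N g').
- f_equal.
  + f_equal; [f_equal; ring | f_equal; ring].
  + apply CInt_minus; now apply ex_antidiag.
Qed.

(** The reflection [u <-> x - u] exchanges the two slots of the kernel.  It gives a
    choice of the slot that the variable [x] occupies. *)
Lemma antidiag_reflect (N : R -> R -> C) (g : R -> C) (x : R) :
  continuous_2C N -> (forall s, continuous (U := C_UniformSpace) g s) ->
  antidiag N g x = antidiag (fun u v => N v u) (fun s => g (- s)) x.
Proof.
intros HN Hg; unfold antidiag.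
assert (Hc : forall u : R, continuous (T := R_UniformSpace) (U := C_UniformSpace)
   (fun u : R => N u (x - u)%R * g (2 * u - x)%R)%C u).
{ intros u; apply (continuous_2_slice_l (fun u x => N u (x - u)%R * g (2 * u - x)%R)%C).
  now apply continuous_antidiag_integrand. }
pose proof (CInt_comp_lin _ (-1) x 0 x Hc) as H.
replace (-1 * 0 + x) with x in H by ring.
replace (-1 * x + x) with 0 in H by ring.
pose proof (opp_RInt_swap (V := C_R_CompleteNormedModule) _ 0 x
  (ex_CInt_continuous _ 0 x (fun z _ => Hc z))) as H'.
change (- CInt (fun u => N u (x - u)%R * g (2 * u - x)%R)%C 0 x
   = CInt (fun u => N u (x - u)%R * g (2 * u - x)%R)%C x 0)%C in H'.
rewrite <- H' in H.
replace (RtoC (-1)) with (- RtoC 1)%C in H by now rewrite <- RtoC_opp.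
transitivity (- - CInt (fun u => N u (x - u)%R * g (2 * u - x)%R)%C 0 x)%C; [ring|].
rewrite <- H.
assert (E : forall c : C, (- (- RtoC 1 * c) = c)%C) by (intros c; ring).
rewrite E.
apply CInt_ext; intros u _; f_equal.
- f_equal; ring.
- f_equal; ring.
Qed.

Lemma antidiag_derive_l (N Nu : R -> R -> C) (g g' : R -> C) (x : R) :
  continuous_2C N -> continuous_2C Nu ->
  (forall s, continuous (U := C_UniformSpace) g' s) ->
  (forall u v, is_derive_C (fun u => N u v) u (Nu u v)) ->
  (forall s, is_derive_C g s (g' s)) ->
  is_derive_C (antidiag N g) x
    (N 0%R x * g (- x)%R + (antidiag Nu g x + antidiag N g' x))%C.
Proof.
intros HN HNu Hg' HdN Hdg.
assert (Hg : forall s, continuous (U := C_UniformSpace) g s).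
{ intros s; exact (is_derive_C_continuous _ _ _ (Hdg s)). }
assert (Hopp : forall h : R -> C, (forall s, continuous (U := C_UniformSpace) h s) ->
  forall s, continuous (U := C_UniformSpace) (fun s => h (- s)) s).
{ intros h Hh s; apply (continuous_comp (V := R_UniformSpace) Ropp h); [|apply Hh].
  apply (continuous_opp (V := R_NormedModule) (fun s => s)), continuous_id. }
assert (Hneg : forall s, continuous (U := C_UniformSpace) (fun s => - g' (- s)%R)%C s).
{ intros s; apply (continuous_opp (V := C_R_NormedModule)); now apply Hopp. }
apply (is_derive_ext (V := C_R_NormedModule)
  (antidiag (fun u v => N v u) (fun s => g (- s)))).
{ intros y; symmetry; now apply antidiag_reflect. }
refine (is_derive_C_eq _ _ _ _ (antidiag_derive_r (fun u v => N v u)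
  (fun u v => Nu v u) (fun s => g (- s)) (fun s => - g' (- s)%R)%C x _ _ _ _ _) _).
- now apply continuous_2_swap.
- now apply continuous_2_swap.
- exact Hneg.
- intros u v; apply HdN.
- intros s.
  refine (is_derive_C_eq _ _ _ _ (is_derive_C_comp g Ropp s (-1) _ (Hdg (- s)) _) _).
  + auto_derive; trivial; ring.
  + replace (-1) with (Ropp 1) by ring; rewrite RtoC_opp; ring.
- f_equal.
  rewrite (antidiag_reflect Nu g) by trivial.
  rewrite (antidiag_reflect N g') by trivial.
  unfold Cminus; f_equal.
  transitivity (RtoC (-1) * antidiag (fun u v => N v u) (fun s => - g' (- s)%R) x)%C.
  { replace (-1) with (Ropp 1) by ring; rewrite RtoC_opp; ring. }
  unfold antidiag; rewrite <- CInt_Cmult_l.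
  + apply CInt_ext; intros u _.
    replace (-1) with (Ropp 1) by ring; rewrite RtoC_opp; ring.
  + apply (ex_antidiag (fun u v => N v u) (fun s => - g' (- s)%R)%C);
      [now apply continuous_2_swap | exact Hneg].
Qed.

(** [A] is differentiable in [u] only, so the first derivative must differentiate [G]
    in [v], the second one [A] in [u]; the two terms [antidiag A g'] that arise
    cancel. *)
Lemma antidiag_second_derivative (G A W : R -> R -> C) (g0 g0' g g' g'' : R -> C)
  (x : R) :
  continuous_2C G -> continuous_2C A -> continuous_2C W ->
  (forall u v, is_derive_C (G u) v (A u v)) ->
  (forall u v, is_derive_C (fun u => A u v) u (W u v)) ->
  (forall u, G u 0 = g0 u) -> (forall v, A 0 v = RtoC 0) ->
  (forall u, is_derive_C g0 u (g0' u)) ->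
  (forall s, is_derive_C g s (g' s)) -> (forall s, is_derive_C g' s (g'' s)) ->
  (forall s, continuous (U := C_UniformSpace) g'' s) ->
  is_derive_C (antidiag G g) x
    (g0 x * g x + (antidiag A g x - antidiag G g' x))%C /\
  is_derive_C (fun x => g0 x * g x + (antidiag A g x - antidiag G g' x))%C x
    (g0' x * g x + antidiag W g x + antidiag G g'' x)%C.
Proof.
intros HG HA HW HGA HAW HG0 HA0 Hg0 Hg Hg' Hg''.
assert (Hcg' : forall s, continuous (U := C_UniformSpace) g' s).
{ intros s; exact (is_derive_C_continuous _ _ _ (Hg' s)). }
split.
- rewrite <- HG0; now apply antidiag_derive_r.
- refine (is_derive_C_eq _ _ _ _ (is_derive_Cplus _ _ _ _ _
   (is_derive_Cmult _ _ _ _ _ (Hg0 x) (Hg x))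
   (is_derive_Cminus _ _ _ _ _
     (antidiag_derive_l A W g g' x HA HW Hcg' HAW Hg)
     (antidiag_derive_r G A g' g'' x HG HA Hg'' HGA Hg'))) _).
  rewrite HG0, HA0; ring.
Qed.

(** * The Goursat problem as an integral equation *)

Definition inner_integral (W : R -> R -> C) (u v : R) : C := CInt (fun s => W s v) 0 u.

Definition goursat_integral (g0 : R -> C) (W : R -> R -> C) (u v : R) : C :=
  (g0 u + CInt (fun r => inner_integral W u r) 0 v)%C.

Lemma continuous_2C_inner_integral (W : R -> R -> C) :
  continuous_2C W -> continuous_2C (inner_integral W).
Proof. exact (continuous_2C_CInt W). Qed.

Lemma continuous_2C_goursat_integral (g0 : R -> C) (W : R -> R -> C) :
  (forall u, continuous (U := C_UniformSpace) g0 u) -> continuous_2C W ->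
  continuous_2C (goursat_integral g0 W).
Proof.
intros Hg0 HW p.
apply (continuous_Cplus (fun p => g0 (fst p))
  (fun p => CInt (fun r => inner_integral W (fst p) r) 0 (snd p))).
- apply (continuous_comp (V := R_UniformSpace) (@fst R R) g0); [|apply Hg0].
  destruct p; apply continuous_fst.
- apply (continuous_2_swap (fun v u => CInt (fun r => inner_integral W u r) 0 v)).
  apply (continuous_2C_CInt (fun r u => inner_integral W u r)).
  now apply continuous_2_swap, continuous_2C_inner_integral.
Qed.

Lemma inner_integral_derive (W : R -> R -> C) (u v : R) :
  continuous_2C W -> is_derive_C (fun u => inner_integral W u v) u (W u v).
Proof.
intros HW; apply (is_derive_CInt (fun s => W s v)).
intros s; now apply continuous_2_slice_l.
Qed.

Lemma inner_integral_0 (W : R -> R -> C) (v : R) : inner_integral W 0 v = RtoC 0.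
Proof. apply CInt_point. Qed.

Lemma goursat_integral_derive (g0 : R -> C) (W : R -> R -> C) (u v : R) :
  continuous_2C W -> is_derive_C (goursat_integral g0 W u) v (inner_integral W u v).
Proof.
intros HW.
refine (is_derive_C_eq _ _ _ _ (is_derive_Cplus (fun _ => g0 u) _ v (RtoC 0) _
  (is_derive_const (V := C_R_NormedModule) (g0 u) v)
  (is_derive_CInt (fun r => inner_integral W u r) 0 v _)) _); [|ring].
intros r; now apply continuous_2_slice_r, continuous_2C_inner_integral.
Qed.

Lemma goursat_integral_0 (g0 : R -> C) (W : R -> R -> C) (u : R) :
  goursat_integral g0 W u 0 = g0 u.
Proof. unfold goursat_integral; rewrite CInt_point; ring. Qed.

Lemma continuous_2C_antidiag_mult (q : R -> C) (P : R -> R -> C) :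
  (forall x, continuous (U := C_UniformSpace) q x) -> continuous_2C P ->
  continuous_2C (fun u v => q (u + v)%R * P u v)%C.
Proof.
intros Hq HP p.
apply (continuous_Cmult (fun p => q (fst p + snd p)%R) (fun p => P (fst p) (snd p)));
  [|apply HP].
apply (continuous_comp (V := R_UniformSpace) (fun p : R * R => fst p + snd p) q);
  [|apply Hq].
apply (continuous_plus (V := R_NormedModule)); destruct p;
  [apply continuous_fst | apply continuous_snd].
Qed.

Lemma Cmod_bounded (g : R -> C) (lo hi : R) :
  lo <= hi -> (forall x, continuous (U := C_UniformSpace) g x) ->
  exists M, 0 < M /\ forall x, lo <= x <= hi -> Cmod (g x) <= M.
Proof.
intros Hlh Hg.
destruct (continuity_ab_maj (fun x => Cmod (g x)) lo hi Hlh) as [m [Hm _]].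
{ intros x _; apply continuity_pt_filterlim.
  apply (filterlim_ext (fun x => norm (g x : C_R_NormedModule)));
    [intros y; symmetry; apply Cmod_norm|].
  rewrite Cmod_norm.
  exact (continuous_comp (U := R_UniformSpace) (V := C_UniformSpace)
    (W := R_UniformSpace) g (fun y : C_R_NormedModule => norm y) x (Hg x)
    (filterlim_norm (K := R_AbsRing) (V := C_R_NormedModule) (g x))). }
exists (Cmod (g m) + 1); split; [pose proof (Cmod_ge_0 (g m)); lra|].
intros x Hx; specialize (Hm x Hx); simpl in Hm; lra.
Qed.

(** The exponential weight gains the factor [1 / lam] under integration; this is what
    makes the Picard map a contraction without restricting [b]. *)
Lemma Cmod_CInt_exp_le (g : R -> C) (L lam v : R) :
  0 <= L -> (forall r, continuous (U := C_UniformSpace) g r) ->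
  (forall r, Rabs r <= Rabs v -> Cmod (g r) <= L * lam * exp (lam * Rabs r)) ->
  Cmod (CInt g 0 v) <= L * exp (lam * Rabs v).
Proof.
intros HL.
assert (K : forall g v, 0 <= v ->
  (forall r, continuous (U := C_UniformSpace) g r) ->
  (forall r, 0 <= r <= v -> Cmod (g r) <= L * lam * exp (lam * r)) ->
  Cmod (CInt g 0 v) <= L * exp (lam * v)).
{ clear g v; intros g v Hv Hg Hb.
  apply Rle_trans with (L * exp (lam * v) - L * exp (lam * 0)).
  2: { rewrite Rmult_0_r, exp_0; lra. }
  rewrite Cmod_norm.
  apply (norm_RInt_le (V := C_R_NormedModule) g (fun r => L * lam * exp (lam * r))
    0 v _ _ Hv).
  - intros r Hr; rewrite <- Cmod_norm; now apply Hb.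
  - apply (RInt_correct (V := C_R_CompleteNormedModule)).
    apply ex_CInt_continuous; auto.
  - apply (is_RInt_derive (V := R_CompleteNormedModule) (fun r => L * exp (lam * r))).
    + intros r _; auto_derive; trivial; ring.
    + intros r _; apply (ex_derive_continuous (V := R_NormedModule)).
      auto_derive; trivial. }
intros Hg Hb; destruct (Rle_dec 0 v) as [Hv|Hv].
- rewrite (Rabs_pos_eq v) in * by trivial; apply K; trivial.
  intros r Hr; rewrite <- (Rabs_pos_eq r) at 2 by lra; apply Hb.
  rewrite Rabs_pos_eq; lra.
- rewrite (Rabs_left v) in * by lra.
  pose proof (CInt_comp_lin g (-1) 0 0 (- v) Hg) as E.
  replace (-1 * 0 + 0) with 0 in E by ring.
  replace (-1 * - v + 0) with v in E by ring.
  rewrite <- E, Cmod_mult, Cmod_R.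
  replace (Rabs (-1)) with 1 by (rewrite Rabs_left; lra).
  rewrite Rmult_1_l; apply K; [lra| |].
  + intros r; apply (continuous_comp (V := R_UniformSpace) (fun y => -1 * y + 0) g);
      [|apply Hg].
    apply (ex_derive_continuous (V := R_NormedModule)); auto_derive; trivial.
  + intros r Hr; rewrite <- (Rabs_pos_eq r) at 2 by lra.
    replace (Rabs r) with (Rabs (-1 * r + 0)).
    2: { replace (-1 * r + 0) with (- r) by ring; apply Rabs_Ropp. }
    apply Hb; replace (-1 * r + 0) with (- r) by ring.
    rewrite Rabs_Ropp, Rabs_pos_eq; lra.
Qed.

Definition picard (q g0 : R -> C) (P : R -> R -> C) : R -> R -> C :=
  goursat_integral g0 (fun s r => q (s + r)%R * P s r)%C.

(** For the weight [exp (2 b M |v|)], [M] a bound of [q]: the inner integral costs a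
    factor [b M], the outer one gains [1 / (2 b M)]. *)
Lemma picard_contraction (b M : R) (q g0 : R -> C) (P Q : R -> R -> C) (K : R) :
  0 < b -> 0 < M -> 0 <= K ->
  (forall x, continuous (U := C_UniformSpace) q x) ->
  (forall x, - (2 * b) <= x <= 2 * b -> Cmod (q x) <= M) ->
  continuous_2C P -> continuous_2C Q ->
  (forall s r, Rabs s <= b -> Rabs r <= b ->
     Cmod (P s r - Q s r) <= K * exp (2 * b * M * Rabs r)) ->
  forall u v, Rabs u <= b -> Rabs v <= b ->
     Cmod (picard q g0 P u v - picard q g0 Q u v)
     <= K / 2 * exp (2 * b * M * Rabs v).
Proof.
intros Hb HM HK Hq HqM HP HQ HPQ u v Hu Hv.
pose proof (continuous_2C_antidiag_mult q P Hq HP) as HqP.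
pose proof (continuous_2C_antidiag_mult q Q Hq HQ) as HqQ.
unfold picard, goursat_integral.
set (WP := fun s r => (q (s + r)%R * P s r)%C) in *.
set (WQ := fun s r => (q (s + r)%R * Q s r)%C) in *.
assert (HcP := continuous_2C_inner_integral WP HqP).
assert (HcQ := continuous_2C_inner_integral WQ HqQ).
replace (g0 u + CInt (fun r => inner_integral WP u r) 0 v
         - (g0 u + CInt (fun r => inner_integral WQ u r) 0 v))%C
  with (CInt (fun r => inner_integral WP u r - inner_integral WQ u r)%C 0 v).
2: { rewrite (CInt_minus (inner_integral WP u) (inner_integral WQ u));
     try (apply ex_CInt_continuous; intros r _; now apply continuous_2_slice_r).
     change (CInt (inner_integral WP u) 0 v) with (CInt (fun r => inner_integral WP u r) 0 v).
     change (CInt (inner_integral WQ u) 0 v) with (CInt (fun r => inner_integral WQ u r) 0 v).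
     ring. }
apply Cmod_CInt_exp_le; [lra| |].
- intros r; apply (continuous_minus (V := C_R_NormedModule));
    now apply continuous_2_slice_r.
- intros r Hr.
  assert (Hrb : Rabs r <= b) by lra.
  unfold inner_integral; rewrite <- CInt_minus.
  2, 3: now apply ex_CInt_2C.
  eapply Rle_trans; [apply (Cmod_CInt_le _ 0 u (M * (K * exp (2 * b * M * Rabs r))))|].
  + intros s _; apply (continuous_minus (V := C_R_NormedModule));
      now apply continuous_2_slice_l.
  + intros s Hs.
    assert (Hsb : Rabs s <= b).
    { unfold Rmin, Rmax in Hs; destruct (Rle_dec 0 u); revert Hu; unfold Rabs;
        repeat destruct Rcase_abs; lra. }
    unfold WP, WQ.
    replace (q (s + r)%R * P s r - q (s + r)%R * Q s r)%C
      with (q (s + r)%R * (P s r - Q s r))%C by ring.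
    rewrite Cmod_mult; apply Rmult_le_compat; try apply Cmod_ge_0; [|now apply HPQ].
    apply HqM; apply Rabs_le_between in Hsb; apply Rabs_le_between in Hrb; lra.
  + rewrite Rminus_0_r.
    assert (0 < exp (2 * b * M * Rabs r)) by apply exp_pos.
    set (e := exp _) in *.
    replace (K / 2 * (2 * b * M) * e) with (b * (M * (K * e))) by field.
    apply Rmult_le_compat_r; [|exact Hu].
    repeat apply Rmult_le_pos; lra.
Qed.

(** Uniformity on the whole plane is available because the iterates to which this is
    applied only depend on clamped arguments. *)
Lemma uniform_geometric_limit (P : nat -> R -> R -> C) (E : R) :
  0 <= E -> (forall k, continuous_2C (P k)) ->
  (forall k u v, Cmod (P (S k) u v - P k u v) <= E / 2 ^ k) ->
  exists L, continuous_2C L /\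
    forall eps : posreal, exists k0, forall k, (k0 <= k)%nat ->
      forall u v, Cmod (L u v - P k u v) <= eps.
Proof.
intros HE Hc HP.
(* Telescoping, in a form exact enough for induction. *)
assert (Htel : forall k j u v, Cmod (P (j + k)%nat u v - P k u v) <= 2 * E / 2 ^ k - 2 * E / 2 ^ (j + k)).
{ intros k j u v; induction j as [|j IH]; simpl.
  - replace (P k u v - P k u v)%C with (RtoC 0) by ring; rewrite Cmod_0; lra.
  - replace (P (S (j + k)) u v - P k u v)%C with
      ((P (S (j + k)) u v - P (j + k)%nat u v) + (P (j + k)%nat u v - P k u v))%C by ring.
    eapply Rle_trans; [apply Cmod_triangle|].
    specialize (HP (j + k)%nat u v).
    assert (0 < 2 ^ (j + k)) by (apply pow_lt; lra).
    replace (2 * E / (2 * 2 ^ (j + k))) with (E / 2 ^ (j + k)) by (field; lra).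
    replace (2 * E / 2 ^ (j + k)) with (2 * (E / 2 ^ (j + k))) in IH by (field; lra).
    lra. }
assert (Hsmall : forall eps : posreal, exists k0, 2 * E / 2 ^ k0 < eps).
{ intros eps.
  destruct (pow_lt_1_zero (/ 2) ltac:(rewrite Rabs_pos_eq; lra) (eps / (2 * E + 1))) as [k0 Hk0].
  { apply Rdiv_lt_0_compat; [apply eps | lra]. }
  exists k0; specialize (Hk0 k0 (Nat.le_refl _)).
  rewrite Rabs_pos_eq in Hk0 by (apply pow_le; lra).
  rewrite pow_inv in Hk0 by lra.
  apply Rlt_div_r in Hk0; [|lra].
  assert (0 < / 2 ^ k0) by (apply Rinv_0_lt_compat, pow_lt; lra).
  unfold Rdiv; nra. }
assert (Hcauchy : forall eps : posreal, exists k0, forall k, (k0 <= k)%nat ->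
  forall u v, Cmod (P k u v - P k0 u v) < eps).
{ intros eps; destruct (Hsmall eps) as [k0 Hk0]; exists k0; intros k Hk u v.
  replace k with ((k - k0) + k0)%nat by lia.
  specialize (Htel k0 (k - k0)%nat u v).
  assert (0 < 2 ^ (k - k0 + k0)) by (apply pow_lt; lra).
  assert (0 <= 2 * E / 2 ^ (k - k0 + k0)) by (apply Rdiv_le_0_compat; lra).
  lra. }
destruct (proj1 (filterlim_locally_cauchy (U := @fct_CompleteSpace (prod R R) C_R_CompleteNormedModule)
  (F := eventually) (fun k (p : R * R) => P k (fst p) (snd p)))) as [L HL].
{ intros eps.
  assert (He : 0 < eps / 2) by (destruct eps; simpl; lra).
  destruct (Hcauchy (mkposreal _ He)) as [k0 Hk0]; simpl in Hk0.
  exists (fun k => (k0 <= k)%nat); split; [now exists k0|].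
  intros k l Hk Hl [u v]; simpl.
  assert (Hkl : Cmod (P l u v - P k u v) < eps).
  { replace (P l u v - P k u v)%C with
      ((P l u v - P k0 u v) + - (P k u v - P k0 u v))%C by ring.
    eapply Rle_lt_trans; [apply Cmod_triangle|]; rewrite Cmod_opp.
    pose proof (Hk0 k Hk u v); pose proof (Hk0 l Hl u v); lra. }
  pose proof (Rmax_Cmod (P l u v - P k u v)%C) as Hmax.
  split.
  - apply Rle_lt_trans with (2 := Hkl), Rle_trans with (2 := Hmax), Rmax_l.
  - apply Rle_lt_trans with (2 := Hkl), Rle_trans with (2 := Hmax), Rmax_r. }
exists (fun u v => L (u, v)).
assert (Hunif : forall eps : posreal, exists k0, forall k, (k0 <= k)%nat ->
      forall u v, Cmod (L (u, v) - P k u v) <= eps).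
{ intros eps.
  assert (He : 0 < eps / 2) by (destruct eps; simpl; lra).
  destruct (proj1 (filterlim_locally _ _) HL (mkposreal _ He)) as [k0 Hk0].
  exists k0; intros k Hk u v.
  destruct (Hk0 k Hk (u, v)) as [H1 H2]; simpl in H1, H2.
  rewrite <- Cmod_opp; replace (- (L (u, v) - P k u v))%C with (P k u v - L (u, v))%C by ring.
  eapply Rle_trans; [apply Cmod_le_components|].
  change (Rabs (fst (P k u v) - fst (L (u, v))) < eps / 2) in H1.
  change (Rabs (snd (P k u v) - snd (L (u, v))) < eps / 2) in H2.
  change (Rabs (fst (P k u v) - fst (L (u, v))) + Rabs (snd (P k u v) - snd (L (u, v))) <= eps).
  lra. }
split; [|exact Hunif].
intros [u0 v0]; apply continuous_C_of_bound; intros eps.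
assert (He : 0 < eps / 4) by (destruct eps; simpl; lra).
destruct (Hunif (mkposreal _ He)) as [k Hk]; simpl in Hk.
generalize (proj1 (filterlim_locally_ball_norm (U := C_R_NormedModule) _ _)
  (Hc k (u0, v0)) (mkposreal _ He)); apply filter_imp.
intros [u v] Huv; unfold ball_norm in Huv; rewrite <- Cmod_norm in Huv; simpl in Huv |- *.
change (Cmod (P k u v - P k u0 v0) < eps / 4) in Huv.
change (Cmod (L (u, v) - L (u0, v0)) < eps).
replace (L (u, v) - L (u0, v0))%C with
  ((L (u, v) - P k u v) + ((P k u v - P k u0 v0) + - (L (u0, v0) - P k u0 v0)))%C by ring.
eapply Rle_lt_trans; [apply Cmod_triangle|].
eapply Rle_lt_trans; [apply Rplus_le_compat_l, Cmod_triangle|].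
rewrite Cmod_opp.
pose proof (Hk k (Nat.le_refl _) u v); pose proof (Hk k (Nat.le_refl _) u0 v0).
destruct eps; simpl in *; lra.
Qed.

Lemma continuous_clamp_const (lo hi : R) (x : R) : continuous (clamp lo hi) x.
Proof.
apply (continuous_clamp (T := R_UniformSpace) (fun _ => lo) (fun _ => hi) (fun y => y));
  [apply continuous_const | apply continuous_const | apply continuous_id].
Qed.

(** Banach's fixed point argument.  Clamping the arguments to [[-b, b]] after each
    Picard step keeps the iterates bounded, hence uniformly convergent on the plane,
    and changes nothing on the square. *)
Lemma volterra_solution (b : R) (q g0 : R -> C) :
  0 < b -> (forall x, continuous (U := C_UniformSpace) q x) ->
  (forall x, continuous (U := C_UniformSpace) g0 x) ->
  exists P : R -> R -> C, continuous_2C P /\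
    forall u v, Rabs u <= b -> Rabs v <= b -> P u v = picard q g0 P u v.
Proof.
intros Hb Hq Hg0.
set (c := clamp (- b) b).
assert (Hc : forall x, Rabs (c x) <= b).
{ intros x; apply Rabs_le_between; apply clamp_in; lra. }
assert (Hcid : forall x, Rabs x <= b -> c x = x).
{ intros x Hx; apply clamp_id; now apply Rabs_le_between. }
set (step := fun (P : R -> R -> C) u v => picard q g0 P (c u) (c v)).
assert (Hpic : forall P, continuous_2C P -> continuous_2C (picard q g0 P)).
{ intros P HP; exact (continuous_2C_goursat_integral g0 _ Hg0
    (continuous_2C_antidiag_mult q P Hq HP)). }
assert (Hstep : forall P, continuous_2C P -> continuous_2C (step P)).
{ intros P HP p.
  apply (continuous_2_comp (T := prod_UniformSpace R_UniformSpace R_UniformSpace)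
    (picard q g0 P) (fun p => c (fst p)) (fun p => c (snd p))).
  - now apply Hpic.
  - apply (continuous_comp (V := R_UniformSpace) (@fst R R) c);
      [destruct p; apply continuous_fst | apply continuous_clamp_const].
  - apply (continuous_comp (V := R_UniformSpace) (@snd R R) c);
      [destruct p; apply continuous_snd | apply continuous_clamp_const]. }
set (P := fix P (k : nat) : R -> R -> C :=
  match k with O => fun _ _ => RtoC 0 | S k => step (P k) end).
assert (HP : forall k, continuous_2C (P k)).
{ induction k as [|k IH]; [intros p; apply continuous_const | now apply Hstep]. }
destruct (Cmod_bounded q (- (2 * b)) (2 * b) ltac:(lra) Hq) as [M [HM HqM]].
destruct (Cmod_bounded g0 (- b) b ltac:(lra) Hg0) as [E [HE Hg0E]].
set (w := fun r => exp (2 * b * M * Rabs r)).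
assert (Hw : forall r, 1 <= w r).
{ intros r; rewrite <- exp_0; unfold w.
  destruct (Req_dec r 0) as [->|Hr]; [rewrite Rabs_R0, Rmult_0_r; lra|].
  left; apply exp_increasing; apply Rmult_lt_0_compat; [nra | now apply Rabs_pos_lt]. }
assert (Hdiff : forall k u v,
  Cmod (P (S k) u v - P k u v) <= E / 2 ^ k * w (c v)).
{ induction k as [|k IH]; intros u v.
  - simpl; unfold step, picard, goursat_integral.
    replace (_ - 0)%C with (g0 (c u)).
    + specialize (Hg0E (c u) (clamp_in (- b) b u ltac:(lra))); specialize (Hw (c v)).
      unfold Rdiv; rewrite Rinv_1; nra.
    + rewrite CInt_zero; [ring|].
      intros r _; apply CInt_zero; intros s _; ring.
  - assert (H2 : 0 < 2 ^ k) by (apply pow_lt; lra).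
    replace (E / 2 ^ S k) with (E / 2 ^ k / 2) by (simpl; field; lra).
    change (Cmod (picard q g0 (P (S k)) (c u) (c v) - picard q g0 (P k) (c u) (c v))
      <= E / 2 ^ k / 2 * w (c v)).
    apply (picard_contraction b M); trivial.
    + apply Rdiv_le_0_compat; lra.
    + intros s r Hs Hr; rewrite <- (Hcid r Hr) at 3; apply IH. }
destruct (uniform_geometric_limit P (E * exp (2 * b * M * b))) as [L [HL Hlim]]; trivial.
{ apply Rmult_le_pos; [lra | left; apply exp_pos]. }
{ intros k u v; eapply Rle_trans; [apply Hdiff|].
  assert (H2 : 0 < 2 ^ k) by (apply pow_lt; lra).
  replace (E * exp (2 * b * M * b) / 2 ^ k) with (E / 2 ^ k * exp (2 * b * M * b))
    by (field; lra).
  apply Rmult_le_compat_l; [apply Rdiv_le_0_compat; lra|].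
  unfold w; destruct (Req_dec (Rabs (c v)) b) as [->|Hne]; [lra|].
  left; apply exp_increasing; specialize (Hc v).
  apply Rmult_lt_compat_l; [nra | lra]. }
exists L; split; [exact HL|].
intros u v Hu Hv.
assert (Hz : Cmod (L u v - picard q g0 L u v) <= 0).
{ apply le_epsilon; intros e He; rewrite Rplus_0_l.
  set (m := exp (2 * b * M * Rabs v)).
  assert (Hm : 0 < m) by apply exp_pos.
  assert (He' : 0 < e / (1 + m)) by (apply Rdiv_lt_0_compat; lra).
  destruct (Hlim (mkposreal _ He')) as [k Hk]; simpl in Hk.
  replace (L u v - picard q g0 L u v)%C with
    ((L u v - P (S k) u v) + - (picard q g0 L u v - P (S k) u v))%C by ring.
  eapply Rle_trans; [apply Cmod_triangle|]; rewrite Cmod_opp.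
  assert (K1 := Hk (S k) ltac:(lia) u v).
  assert (K2 : Cmod (picard q g0 L u v - P (S k) u v) <= e / (1 + m) / 2 * m).
  { change (P (S k) u v) with (picard q g0 (P k) (c u) (c v)).
    rewrite (Hcid u Hu), (Hcid v Hv).
    apply (picard_contraction b M); trivial; [lra|].
    intros s r _ _; specialize (Hk k (Nat.le_refl _) s r).
    eapply Rle_trans; [exact Hk|].
    specialize (Hw r); unfold w in Hw; nra. }
  assert (K3 : e / (1 + m) * (1 + m) = e) by (field; lra).
  nra. }
assert (H0 : (L u v - picard q g0 L u v)%C = RtoC 0).
{ apply Cmod_eq_0, Rle_antisym; [exact Hz | apply Cmod_ge_0]. }
replace (L u v) with (L u v - picard q g0 L u v + picard q g0 L u v)%C by ring.
rewrite H0; ring.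
Qed.

(** * Solutions of the Goursat problem on the hexagon *)

(** A cluster point of the relative neighbourhoods of [x] can only be [x]: testing on
    balls, [x] itself belongs to each of them. *)
Lemma is_derive_in_of_derive (D : R -> Prop) (g : R -> C) (x : R) (l : C) :
  D x -> is_derive_C g x l -> is_derive_in D g x l.
Proof.
intros Dx [Hl Hd]; split; [exact Hl|].
intros x' Hx'.
assert (E : x = x').
{ apply cond_eq; intros eps He.
  exact (locally_singleton x _ (Hx' _ (locally_ball (T := R_UniformSpace) x'
    (mkposreal eps He))) Dx). }
subst x'; intros eps.
exact (filter_imp _ _ (fun y Hy _ => Hy) (Hd x (fun P HP => HP) eps)).
Qed.

(** Its derivative [q / 2] contributes the term [q g] to [(T g)'']. *)
Definition goursat_data (q : R -> C) (h : C) (u : R) : C :=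
  (h / 2 + / 2 * CInt q 0 u)%C.

Lemma goursat_data_derive (q : R -> C) (h : C) (u : R) :
  (forall x, continuous (U := C_UniformSpace) q x) ->
  is_derive_C (goursat_data q h) u (/ 2 * q u)%C.
Proof.
intros Hq.
refine (is_derive_C_eq _ _ _ _ (is_derive_Cplus (fun _ => h / 2)%C _ u (RtoC 0) _
  (is_derive_const (V := C_R_NormedModule) (h / 2)%C u)
  (is_derive_Cmult (fun _ => / 2)%C _ u (RtoC 0) _
    (is_derive_const (V := C_R_NormedModule) (/ 2)%C u)
    (is_derive_CInt q 0 u Hq))) _); ring.
Qed.

(** The fixed point [P] is only right on the square; applying the integral operator to
    it once more gives a function that is differentiable on the whole plane and agrees
    with [P] on the square. *)
Lemma goursat_exists (b : R) (q qc : R -> C) (h : C) :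
  0 < b -> (forall x, continuous (U := C_UniformSpace) qc x) ->
  (forall x, seg b x -> qc x = q x) ->
  exists H, is_goursat_solution b q h H.
Proof.
intros Hb Hqc Hq.
assert (Hg0 : forall u, continuous (U := C_UniformSpace) (goursat_data qc h) u).
{ intros u; exact (is_derive_C_continuous _ _ _ (goursat_data_derive qc h u Hqc)). }
destruct (volterra_solution b qc (goursat_data qc h) Hb Hqc Hg0) as [P [HP Heq]].
assert (HW := continuous_2C_antidiag_mult qc P Hqc HP).
exists (picard qc (goursat_data qc h) P); repeat split.
- intros p Hp.
  intros A HA.
  generalize (continuous_2C_goursat_integral _ _ Hg0 HW p A HA).
  unfold filtermap, within; apply filter_imp; intros y Hy _; exact Hy.
- exists (inner_integral (fun s r => qc (s + r)%R * P s r)%C); split; intros u v Huv.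
  + apply is_derive_in_of_derive; [exact Huv|].
    exact (goursat_integral_derive _ _ u v HW).
  + apply is_derive_in_of_derive; [exact Huv|].
    destruct Huv as [Hu [Hv Huv]].
    refine (is_derive_C_eq _ _ _ _ (inner_integral_derive _ u v HW) _).
    rewrite (Heq u v Hu Hv), Hq; [reflexivity|].
    now apply Rabs_le_between.
- intros u Hu; unfold picard; rewrite goursat_integral_0; unfold goursat_data.
  do 2 f_equal; apply CInt_ext; intros x Hx; apply Hq.
  apply Rabs_le_between in Hu; unfold seg; revert Hx; unfold Rmin, Rmax.
  destruct (Rle_dec 0 u); lra.
- intros v Hv; unfold picard, goursat_integral, goursat_data.
  rewrite CInt_point.
  rewrite (CInt_zero (fun r => inner_integral _ 0 r)); [ring | intros r _; apply inner_integral_0].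
Qed.

(** The slices of the hexagon are the intervals [[hex_lo b u, hex_hi b u]]; each
    contains [0], so solutions can be integrated from the axes inside the hexagon. *)
Definition hex_lo (b u : R) : R := Rmax (- b) (- b - u).
Definition hex_hi (b u : R) : R := Rmin b (b - u).

Lemma hexagon_slice (b u v : R) :
  Rabs u <= b -> (hexagon b u v <-> hex_lo b u <= v <= hex_hi b u).
Proof.
intros Hu; unfold hexagon, hex_lo, hex_hi; rewrite !Rabs_le_between in *.
unfold Rmax, Rmin; repeat destruct Rle_dec; lra.
Qed.

Lemma hexagon_sym (b u v : R) : hexagon b u v <-> hexagon b v u.
Proof. unfold hexagon; rewrite (Rplus_comm u v); tauto. Qed.

Lemma hexagon_0 (b u : R) : 0 < b -> Rabs u <= b -> hexagon b u 0.
Proof.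
intros Hb Hu; unfold hexagon; rewrite Rplus_0_r, Rabs_R0; repeat split; lra.
Qed.

Lemma hex_lo_le_hi (b u : R) : Rabs u <= b -> hex_lo b u <= 0 <= hex_hi b u.
Proof.
rewrite Rabs_le_between; unfold hex_lo, hex_hi, Rmax, Rmin.
repeat destruct Rle_dec; lra.
Qed.

Definition hex_retract (b : R) (p : R * R) : R * R :=
  let u := clamp (- b) b (fst p) in (u, clamp (hex_lo b u) (hex_hi b u) (snd p)).

Lemma hex_retract_in (b : R) (p : R * R) :
  0 < b -> hexagon b (fst (hex_retract b p)) (snd (hex_retract b p)).
Proof.
intros Hb; unfold hex_retract; simpl.
assert (Hu : Rabs (clamp (- b) b (fst p)) <= b).
{ apply Rabs_le_between, clamp_in; lra. }
apply hexagon_slice; [exact Hu|].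
apply clamp_in; pose proof (hex_lo_le_hi b _ Hu); lra.
Qed.

Lemma hex_retract_id (b u v : R) : hexagon b u v -> hex_retract b (u, v) = (u, v).
Proof.
intros H; pose proof H as [Hu _]; unfold hex_retract; simpl.
rewrite (clamp_id (- b) b u) by now apply Rabs_le_between.
rewrite clamp_id; [reflexivity | now apply hexagon_slice].
Qed.

Lemma continuous_hex_retract (b : R) (p : R * R) :
  continuous (T := prod_UniformSpace R_UniformSpace R_UniformSpace)
    (U := prod_UniformSpace R_UniformSpace R_UniformSpace) (hex_retract b) p.
Proof.
assert (H1 : continuous (T := prod_UniformSpace R_UniformSpace R_UniformSpace)
  (U := R_UniformSpace) fst p) by (destruct p; apply continuous_fst).
assert (H2 : continuous (T := prod_UniformSpace R_UniformSpace R_UniformSpace)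
  (U := R_UniformSpace) snd p) by (destruct p; apply continuous_snd).
assert (Hu : continuous (T := prod_UniformSpace R_UniformSpace R_UniformSpace)
  (U := R_UniformSpace) (fun p => clamp (- b) b (fst p)) p).
{ apply continuous_clamp; trivial; apply continuous_const. }
change (continuous (T := prod_UniformSpace R_UniformSpace R_UniformSpace)
  (U := C_UniformSpace) (hex_retract b) p).
apply continuous_C_iff; split; [exact Hu|]; simpl.
apply (continuous_clamp (fun p => hex_lo b (clamp (- b) b (fst p)))
  (fun p => hex_hi b (clamp (- b) b (fst p))) snd); [| |exact H2].
- apply continuous_Rmax_comp; [apply continuous_const|].
  apply (continuous_minus (V := R_NormedModule)); [apply continuous_const | exact Hu].
- apply continuous_Rmin_comp; [apply continuous_const|].
  apply (continuous_minus (V := R_NormedModule)); [apply continuous_const | exact Hu].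
Qed.

Lemma continuous_on_of_continuous (D : R -> Prop) (g : R -> C) :
  (forall x, continuous (U := C_UniformSpace) g x) ->
  continuous_on (T := R_UniformSpace) (U := C_UniformSpace) D g.
Proof.
intros Hg x _ A HA; generalize (Hg x A HA).
unfold filtermap, within; apply filter_imp; auto.
Qed.

(** Integrating [H_uv = q H] along [u] from the axis [u = 0], where [H_v = 0] because
    [H] is constant there, and then [H_v] along [v].  The function [P] extends [H]
    continuously to the plane by retraction to the hexagon. *)
Lemma goursat_solution_integral (b : R) (q qc : R -> C) (h : C) (H : R -> R -> C) :
  0 < b -> (forall x, continuous (U := C_UniformSpace) qc x) ->
  (forall x, seg b x -> qc x = q x) ->
  is_goursat_solution b q h H ->
  exists P : R -> R -> C, continuous_2C P /\
    forall u v, hexagon b u v ->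
      P u v = H u v /\ H u v = picard qc (goursat_data qc h) P u v.
Proof.
intros Hb Hqc Hq [HH [[Hv [HHv HHuv]] [Hu0 H0v]]].
set (P := fun u v => H (fst (hex_retract b (u, v))) (snd (hex_retract b (u, v)))).
assert (HP : continuous_2C P).
{ intros p.
  apply (continuous_ext (U := C_UniformSpace)
    (fun p => (fun p => H (fst p) (snd p)) (hex_retract b p)));
    [now intros [u v]|].
  apply (continuous_retract (T := prod_UniformSpace R_UniformSpace R_UniformSpace)
    (fun p => hexagon b (fst p) (snd p)) (fun p => H (fst p) (snd p))
    (hex_retract b)).
  - intros y; now apply hex_retract_in.
  - apply continuous_hex_retract.
  - exact HH. }
assert (HPH : forall u v, hexagon b u v -> P u v = H u v).
{ intros u v Huv; unfold P; now rewrite hex_retract_id. }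
assert (HW := continuous_2C_antidiag_mult qc P Hqc HP).
set (W := fun u v => (qc (u + v)%R * P u v)%C) in *.
assert (HWq : forall u v, hexagon b u v -> W u v = (q (u + v)%R * H u v)%C).
{ intros u v Huv; unfold W; rewrite (HPH u v Huv), Hq; [reflexivity|].
  apply Rabs_le_between; apply Huv. }
assert (Hv0 : forall v, Rabs v <= b -> Hv 0 v = RtoC 0).
{ intros v Hvb.
  assert (H00 : Rabs 0 <= b) by (rewrite Rabs_R0; lra).
  assert (Hs := fun v => hexagon_slice b 0 v H00).
  assert (H0h : hexagon b 0 v) by now apply hexagon_sym, hexagon_0.
  apply (is_derive_in_const (fun v' => hexagon b 0 v') (hex_lo b 0) (hex_hi b 0)
    (fun v' => H 0 v') (h / 2)%C (Hv 0 v) v); trivial.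
  - unfold hex_lo, hex_hi, Rmax, Rmin; repeat destruct Rle_dec; lra.
  - intros y Hy; apply H0v, Hy.
  - now apply HHv. }
assert (HHv' : forall u v, hexagon b u v -> Hv u v = inner_integral W u v).
{ intros u v Huv; assert (Hvb : Rabs v <= b) by apply Huv.
  unfold inner_integral.
  rewrite (CInt_derive_in (fun u' => hexagon b u' v) (hex_lo b v) (hex_hi b v)
    (fun u' => Hv u' v) (fun u' => W u' v)).
  - rewrite Hv0 by trivial; ring.
  - intros z; rewrite hexagon_sym; now apply hexagon_slice.
  - now apply hexagon_sym, hexagon_0.
  - exact Huv.
  - intros z Hz; rewrite HWq by trivial; now apply HHuv.
  - apply continuous_on_of_continuous; intros z; now apply continuous_2_slice_l. }
exists P; split; [exact HP|]; intros u v Huv; split; [now apply HPH|].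
assert (Hub : Rabs u <= b) by apply Huv.
unfold picard, goursat_integral; fold W.
rewrite (CInt_derive_in (fun v' => hexagon b u v') (hex_lo b u) (hex_hi b u)
    (fun v' => H u v') (fun v' => inner_integral W u v')).
- rewrite (Hu0 u Hub); unfold goursat_data.
  rewrite (CInt_ext qc q); [ring|].
  intros x Hx; apply Hq; apply Rabs_le_between in Hub; unfold seg.
  revert Hx; unfold Rmin, Rmax; destruct (Rle_dec 0 u); lra.
- intros z; now apply hexagon_slice.
- now apply hexagon_0.
- exact Huv.
- intros z Hz; rewrite <- HHv' by trivial; now apply HHv.
- apply continuous_on_of_continuous; intros z.
  now apply continuous_2_slice_r, continuous_2C_inner_integral.
Qed.

(** * The transmutation property *)

(** The operator [T_h] in characteristic coordinates. *)
Definition transmute (G : R -> R -> C) (g : R -> C) (x : R) : C :=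
  (g x + 2 * antidiag G g x)%C.

(** The substitution [s = 2 u - x]. *)
Lemma opT_transmute (b : R) (q : R -> C) (h : C) (G : R -> R -> C) (g : R -> C) (x : R) :
  continuous_2C G ->
  (forall u v, hexagon b u v -> goursat b q h u v = G u v) ->
  (forall s, continuous (U := C_UniformSpace) g s) ->
  seg b x -> opT b q h g x = transmute G g x.
Proof.
intros HG HgG Hg Hx; unfold opT, transmute; f_equal.
set (k := fun s => (G ((x + s) / 2)%R ((x - s) / 2)%R * g s)%C).
assert (Hk : forall s, continuous (U := C_UniformSpace) k s).
{ intros s; apply (continuous_Cmult (fun s => G ((x + s) / 2)%R ((x - s) / 2)%R) g);
    [|apply Hg].
  apply (continuous_2_comp (T := R_UniformSpace) G (fun s => (x + s) / 2)
    (fun s => (x - s) / 2)); [exact HG| |];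
    apply (ex_derive_continuous (V := R_NormedModule)); auto_derive; trivial. }
rewrite (CInt_ext _ k).
- pose proof (CInt_comp_lin k 2 (- x) 0 x Hk) as E.
  replace (2 * 0 + - x) with (- x) in E by ring.
  replace (2 * x + - x) with x in E by ring.
  rewrite <- E; f_equal; apply CInt_ext; intros u _; unfold k.
  replace ((x + (2 * u + - x)) / 2) with u by field.
  replace ((x - (2 * u + - x)) / 2) with (x - u) by field.
  now replace (2 * u + - x) with (2 * u - x) by ring.
- intros s Hs; unfold kernelK, k; rewrite HgG; [reflexivity|].
  unfold seg in Hx; revert Hs; unfold Rmin, Rmax; destruct (Rle_dec (- x) x); intros Hs;
  unfold hexagon; rewrite !Rabs_le_between; lra.
Qed.

(** On the antidiagonal [u + v = x] the factor [q (u + v)] is the constant [q x]. *)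
Lemma antidiag_equation (b : R) (qc : R -> C) (P G : R -> R -> C) (g : R -> C) (x : R) :
  continuous_2C G -> (forall s, continuous (U := C_UniformSpace) g s) ->
  (forall u v, hexagon b u v -> P u v = G u v) -> seg b x ->
  antidiag (fun u v => qc (u + v)%R * P u v)%C g x = (qc x * antidiag G g x)%C.
Proof.
intros HG Hg HPG Hx; unfold antidiag.
rewrite <- CInt_Cmult_l by now apply ex_antidiag.
apply CInt_ext; intros u Hu; rewrite HPG.
- replace (u + (x - u)) with x by ring; ring.
- unfold seg in Hx; revert Hu; unfold Rmin, Rmax; destruct (Rle_dec 0 x); intros Hu;
  unfold hexagon; rewrite !Rabs_le_between; lra.
Qed.

(** The intertwining relation [(T g)'' = q T g + T (g'')] with its initial values.  The
    slope [g' 0 + h g 0] comes from [G (0, 0) = h / 2]. *)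
Lemma opT_ode (b : R) (q qc : R -> C) (h : C) :
  0 < b -> (forall x, continuous (U := C_UniformSpace) qc x) ->
  (forall x, seg b x -> qc x = q x) ->
  exists G : R -> R -> C, continuous_2C G /\
    (forall g, (forall s, continuous (U := C_UniformSpace) g s) ->
       forall x, seg b x -> opT b q h g x = transmute G g x) /\
    (forall g g' g'' : R -> C,
       (forall s, is_derive_C g s (g' s)) -> (forall s, is_derive_C g' s (g'' s)) ->
       (forall s, continuous (U := C_UniformSpace) g'' s) ->
       exists y' : R -> C, y' 0 = (g' 0%R + h * g 0%R)%C /\
         (forall x, is_derive_C (transmute G g) x (y' x)) /\
         (forall x, seg b x -> is_derive_C y' x
            (q x * transmute G g x + transmute G g'' x)%C)).
Proof.
intros Hb Hqc Hq.
assert (Hsol : is_goursat_solution b q h (goursat b q h)).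
{ unfold goursat; apply epsilon_spec; now apply (goursat_exists b q qc h). }
destruct (goursat_solution_integral b q qc h _ Hb Hqc Hq Hsol) as [P [HP HPG]].
set (g0 := goursat_data qc h) in *.
assert (Hg0 : forall u, is_derive_C g0 u (/ 2 * qc u)%C).
{ intros u; now apply goursat_data_derive. }
assert (Hcg0 : forall u, continuous (U := C_UniformSpace) g0 u).
{ intros u; exact (is_derive_C_continuous _ _ _ (Hg0 u)). }
assert (HW := continuous_2C_antidiag_mult qc P Hqc HP).
set (W := fun u v => (qc (u + v)%R * P u v)%C) in *.
set (G := goursat_integral g0 W).
assert (HG : continuous_2C G) by now apply continuous_2C_goursat_integral.
assert (HPG' : forall u v, hexagon b u v -> P u v = G u v).
{ intros u v Huv; destruct (HPG u v Huv) as [E1 E2]; now rewrite E1. }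
exists G; split; [exact HG|]; split.
- intros g Hg x Hx; apply opT_transmute; trivial.
  intros u v Huv; apply (HPG u v Huv).
- intros g g' g'' Hg Hg' Hg''.
  assert (Hcg : forall s, continuous (U := C_UniformSpace) g s).
  { intros s; exact (is_derive_C_continuous _ _ _ (Hg s)). }
  assert (D := fun x => antidiag_second_derivative G (inner_integral W) W g0
    (fun u => / 2 * qc u)%C g g' g'' x HG (continuous_2C_inner_integral W HW) HW
    (fun u v => goursat_integral_derive g0 W u v HW)
    (fun u v => inner_integral_derive W u v HW) (goursat_integral_0 g0 W) (inner_integral_0 W)
    Hg0 Hg Hg' Hg'').
  set (S := fun x => (g0 x * g x + (antidiag (inner_integral W) g x - antidiag G g' x))%C) in D.
  assert (D2 : forall (u : R -> C) x l, is_derive_C u x l ->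
    is_derive_C (fun y => 2 * u y)%C x (2 * l)%C).
  { intros u x l Hu.
    refine (is_derive_C_eq _ _ _ _ (is_derive_Cmult (fun _ => RtoC 2) u x (RtoC 0) l
      (is_derive_const (V := C_R_NormedModule) (RtoC 2) x) Hu) _); ring. }
  exists (fun x => g' x + 2 * S x)%C; split; [|split].
  + unfold S, g0, goursat_data, antidiag; rewrite !CInt_point; field.
  + intros x; apply is_derive_Cplus; [apply Hg | apply D2, D].
  + intros x Hx.
    refine (is_derive_C_eq _ _ _ _ (is_derive_Cplus _ _ _ _ _ (Hg' x)
      (D2 _ _ _ (proj2 (D x)))) _).
    unfold W; rewrite (antidiag_equation b qc P G g x) by trivial.
    unfold transmute; rewrite (Hq x Hx); field.
Qed.

Lemma antidiag_plus (G : R -> R -> C) (g h : R -> C) (x : R) :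
  continuous_2C G -> (forall s, continuous (U := C_UniformSpace) g s) ->
  (forall s, continuous (U := C_UniformSpace) h s) ->
  antidiag G (fun s => g s + h s)%C x = (antidiag G g x + antidiag G h x)%C.
Proof.
intros HG Hg Hh; unfold antidiag; rewrite <- CInt_plus by now apply ex_antidiag.
apply CInt_ext; intros u _; ring.
Qed.

Lemma transmute_plus (G : R -> R -> C) (g h : R -> C) (x : R) :
  continuous_2C G -> (forall s, continuous (U := C_UniformSpace) g s) ->
  (forall s, continuous (U := C_UniformSpace) h s) ->
  transmute G (fun s => g s + h s)%C x = (transmute G g x + transmute G h x)%C.
Proof.
intros HG Hg Hh; unfold transmute; rewrite antidiag_plus by trivial; ring.
Qed.

Lemma transmute_Cmult_l (G : R -> R -> C) (c : C) (g : R -> C) (x : R) :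
  continuous_2C G -> (forall s, continuous (U := C_UniformSpace) g s) ->
  transmute G (fun s => c * g s)%C x = (c * transmute G g x)%C.
Proof.
intros HG Hg; unfold transmute.
replace (antidiag G (fun s => c * g s)%C x) with (c * antidiag G g x)%C; [ring|].
unfold antidiag; rewrite <- CInt_Cmult_l by now apply ex_antidiag.
apply CInt_ext; intros u _; ring.
Qed.

Lemma transmute_0 (G : R -> R -> C) (g : R -> C) : transmute G g 0 = g 0.
Proof. unfold transmute, antidiag; rewrite CInt_point; ring. Qed.

(** * Formal powers *)

(** [f * phi_quot f n] and [psi_quot f n / f] are the two systems of generalized powers
    attached to [f]; for [n] odd they are built on [X] and [Xtilde], for [n] even on
    [Xtilde] and [X].  Sorted in this way, the weights in the recursion no longer
    depend on parity: [/ f^2] from [psi_quot] to [phi_quot], [f^2] back. *)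
Definition phi_quot (f : R -> C) (n : nat) : R -> C :=
  if Nat.odd n then Xpow f n else Xtpow f n.

Definition psi_quot (f : R -> C) (n : nat) : R -> C :=
  if Nat.odd n then Xtpow f n else Xpow f n.

Lemma phi_quot_S (f : R -> C) (m : nat) (x : R) :
  phi_quot f (S m) x = (RtoC (INR (S m)) * CInt (fun s => psi_quot f m s * / Cpow (f s) 2) 0 x)%C.
Proof.
unfold phi_quot, psi_quot; rewrite Nat.odd_succ, <- Nat.negb_odd.
destruct (Nat.odd m) eqn:E; cbn [negb Xpow Xtpow]; unfold alt_pow.
- now rewrite <- Nat.negb_odd, E.
- now rewrite Nat.even_succ, E.
Qed.

Lemma psi_quot_S (f : R -> C) (m : nat) (x : R) :
  psi_quot f (S m) x = (RtoC (INR (S m)) * CInt (fun s => phi_quot f m s * Cpow (f s) 2) 0 x)%C.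
Proof.
unfold phi_quot, psi_quot; rewrite Nat.odd_succ, <- Nat.negb_odd.
destruct (Nat.odd m) eqn:E; cbn [negb Xpow Xtpow]; unfold alt_pow.
- now rewrite Nat.even_succ, E.
- now rewrite <- Nat.negb_odd, E.
Qed.

Lemma phi_quot_0 (f : R -> C) (x : R) : phi_quot f 0 x = RtoC 1.
Proof. reflexivity. Qed.

Lemma psi_quot_0 (f : R -> C) (x : R) : psi_quot f 0 x = RtoC 1.
Proof. reflexivity. Qed.

Lemma seg_between (b x s : R) :
  0 < b -> seg b x -> Rmin 0 x <= s <= Rmax 0 x -> seg b s.
Proof.
intros Hb; unfold seg, Rmin, Rmax; destruct (Rle_dec 0 x); lra.
Qed.

Lemma phi_psi_quot_ext (b : R) (f g : R -> C) (n : nat) :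
  0 < b -> (forall x, seg b x -> f x = g x) ->
  forall x, seg b x -> phi_quot f n x = phi_quot g n x /\ psi_quot f n x = psi_quot g n x.
Proof.
intros Hb Hfg; induction n as [|n IH]; intros x Hx; [split; reflexivity|].
rewrite !phi_quot_S, !psi_quot_S; split; f_equal; apply CInt_ext; intros s Hs;
  assert (Hs' : seg b s) by (apply (seg_between b x); trivial; lra);
  destruct (IH s Hs') as [E1 E2]; now rewrite ?E1, ?E2, (Hfg s Hs').
Qed.

(** Replacing [f] by [1/f] exchanges the two systems. *)
Lemma phi_psi_quot_inv (b : R) (f : R -> C) (n : nat) :
  0 < b -> (forall x, seg b x -> f x <> RtoC 0) ->
  forall x, seg b x -> phi_quot (fun y => / f y)%C n x = psi_quot f n x /\
                       psi_quot (fun y => / f y)%C n x = phi_quot f n x.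
Proof.
intros Hb Hf; induction n as [|n IH]; intros x Hx; [split; reflexivity|].
rewrite !phi_quot_S, !psi_quot_S; split; f_equal; apply CInt_ext; intros s Hs;
  assert (Hs' : seg b s) by (apply (seg_between b x); trivial; lra);
  destruct (IH s Hs') as [E1 E2]; assert (Hfs := Hf s Hs');
  rewrite ?E1, ?E2; simpl; field; trivial.
Qed.

Definition monomial (n : nat) (s : R) : C := RtoC (s ^ n).

Lemma continuous_monomial (n : nat) (s : R) : continuous (U := C_UniformSpace) (monomial n) s.
Proof.
apply (continuous_RtoC (T := R_UniformSpace) (fun s => s ^ n)).
apply (ex_derive_continuous (V := R_NormedModule)); auto_derive; trivial.
Qed.

Lemma is_derive_monomial (n : nat) (s : R) :
  is_derive_C (monomial n) s (RtoC (INR n) * monomial (pred n) s)%C.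
Proof.
unfold monomial; rewrite <- RtoC_mult; apply (is_derive_RtoC (fun s => s ^ n)).
auto_derive; trivial; ring.
Qed.

Lemma is_derive_C_const_mult (c : C) (u : R -> C) (x : R) (l : C) :
  is_derive_C u x l -> is_derive_C (fun y => c * u y)%C x (c * l)%C.
Proof.
intros Hu.
refine (is_derive_C_eq _ _ _ _ (is_derive_Cmult (fun _ => c) u x (RtoC 0) l
  (is_derive_const (V := C_R_NormedModule) c x) Hu) _); ring.
Qed.

Lemma monomial_0 (n : nat) : monomial n 0 = if Nat.eqb n 0 then RtoC 1 else RtoC 0.
Proof. destruct n; unfold monomial; simpl; [reflexivity | now rewrite Rmult_0_l]. Qed.

(** With [y = T[x^n]], the Wronskian [w = f y' - f1 y] has the derivative
    [n (n - 1) f T[x^(n-2)]] because [f] solves the homogeneous equation, and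
    [(y / f)' = w / f^2].  The initial slope of [f] being the parameter [h] of [T],
    [w 0] is the derivative of [x^n] at [0], so that by induction [w] is [n] times
    [psi_quot f (n - 1)] and [y / f] is [phi_quot f n]. *)
Lemma transmute_powers (b : R) (f f1 f2 : R -> C) (q : R -> C) (G : R -> R -> C) :
  0 < b ->
  (forall x, seg b x -> is_derive_C f x (f1 x)) ->
  (forall x, seg b x -> is_derive_C f1 x (f2 x)) ->
  (forall x, seg b x -> f x <> RtoC 0) -> f 0 = RtoC 1 ->
  (forall x, seg b x -> q x = (f2 x / f x)%C) ->
  continuous_2C G ->
  (forall g g' g'' : R -> C,
       (forall s, is_derive_C g s (g' s)) -> (forall s, is_derive_C g' s (g'' s)) ->
       (forall s, continuous (U := C_UniformSpace) g'' s) ->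
       exists y' : R -> C, y' 0 = (g' 0%R + f1 0%R * g 0%R)%C /\
         (forall x, is_derive_C (transmute G g) x (y' x)) /\
         (forall x, seg b x -> is_derive_C y' x
            (q x * transmute G g x + transmute G g'' x)%C)) ->
  forall n x, seg b x -> transmute G (monomial n) x = (f x * phi_quot f n x)%C.
Proof.
intros Hb Hf Hf1 Hfn0 Hf0 Hq HG Hode.
assert (H0b : seg b 0) by (unfold seg; lra).
assert (Hcf : forall x, seg b x -> continuous (U := C_UniformSpace) f x).
{ intros x Hx; exact (is_derive_C_continuous _ _ _ (Hf x Hx)). }
assert (Hmono : forall n, exists y' : R -> C,
  y' 0 = (RtoC (INR n) * monomial (pred n) 0%R + f1 0%R * monomial n 0%R)%C /\
  (forall x, is_derive_C (transmute G (monomial n)) x (y' x)) /\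
  (forall x, seg b x -> is_derive_C y' x (q x * transmute G (monomial n) x
     + RtoC (INR n) * (RtoC (INR (pred n)) * transmute G (monomial (pred (pred n))) x))%C)).
{ intros n.
  destruct (Hode (monomial n) (fun s => RtoC (INR n) * monomial (pred n) s)%C
    (fun s => RtoC (INR n) * (RtoC (INR (pred n)) * monomial (pred (pred n)) s))%C)
    as [y' [Hy0 [Hy Hy']]].
  - apply is_derive_monomial.
  - intros s; apply is_derive_C_const_mult, is_derive_monomial.
  - intros s; apply (continuous_Cmult (T := R_UniformSpace)); [apply continuous_const|].
    apply (continuous_Cmult (T := R_UniformSpace)); [apply continuous_const|].
    apply continuous_monomial.
  - exists y'; split; [exact Hy0 | split; [exact Hy |]].
    intros x Hx; specialize (Hy' x Hx).
    rewrite transmute_Cmult_l in Hy'; trivial.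
    2: { intros s; apply (continuous_Cmult (T := R_UniformSpace));
         [apply continuous_const | apply continuous_monomial]. }
    rewrite transmute_Cmult_l in Hy'; trivial.
    apply continuous_monomial. }
assert (Hcmono : forall n x, continuous (U := C_UniformSpace) (transmute G (monomial n)) x).
{ intros n x; destruct (Hmono n) as [y' [_ [Hy _]]].
  exact (is_derive_C_continuous _ _ _ (Hy x)). }
induction n as [n IH] using (well_founded_induction Wf_nat.lt_wf).
destruct (Hmono n) as [y' [Hy0 [Hy Hy']]].
set (y := transmute G (monomial n)) in *.
set (w := fun x => (f x * y' x - f1 x * y x)%C).
set (w' := fun x => (RtoC (INR n) * (RtoC (INR (pred n)) *
                     (f x * transmute G (monomial (pred (pred n))) x)))%C).
assert (Hw' : forall x, seg b x -> is_derive_C w x (w' x)).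
{ intros x Hx.
  refine (is_derive_C_eq _ _ _ _ (is_derive_Cminus _ _ _ _ _
    (is_derive_Cmult _ _ _ _ _ (Hf x Hx) (Hy' x Hx))
    (is_derive_Cmult _ _ _ _ _ (Hf1 x Hx) (Hy x))) _).
  rewrite (Hq x Hx); unfold w'; field; now apply Hfn0. }
assert (Hcw : forall x, seg b x -> continuous (U := C_UniformSpace) w x).
{ intros x Hx; exact (is_derive_C_continuous _ _ _ (Hw' x Hx)). }
assert (Hcfy : forall m x, seg b x ->
  continuous (U := C_UniformSpace) (fun x => f x * transmute G (monomial m) x)%C x).
{ intros m x Hx; apply (continuous_Cmult (T := R_UniformSpace)); auto. }
assert (Hcw' : forall x, seg b x -> continuous (U := C_UniformSpace) w' x).
{ intros x Hx; apply (continuous_Cmult (T := R_UniformSpace)); [apply continuous_const|].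
  apply (continuous_Cmult (T := R_UniformSpace)); [apply continuous_const|]; auto. }
(* For n = 0 and n = 1 the convention pred 0 = 0 is harmless, the factor n (n - 1)
   being zero. *)
assert (Hw : forall x, seg b x -> w x = (RtoC (INR n) * psi_quot f (pred n) x)%C).
{ intros x Hx.
  assert (Ew : CInt w' 0 x = (w x - w 0%R)%C).
  { apply CInt_derive; intros s Hs;
      [apply Hw' | apply Hcw']; now apply (seg_between b x). }
  assert (Ew0 : w 0 = (RtoC (INR n) * monomial (pred n) 0%R)%C).
  { unfold w; rewrite Hy0, Hf0; unfold y; rewrite transmute_0; ring. }
  replace (w x) with (CInt w' 0 x + w 0%R)%C by (rewrite Ew; ring).
  rewrite Ew0; unfold w'.
  rewrite CInt_Cmult_l.
  2: { apply ex_CInt_continuous; intros s Hs.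
       apply (continuous_Cmult (T := R_UniformSpace)); [apply continuous_const|].
       apply Hcfy; now apply (seg_between b x). }
  rewrite CInt_Cmult_l.
  2: { apply ex_CInt_continuous; intros s Hs; apply Hcfy; now apply (seg_between b x). }
  destruct n as [|[|m]].
  - simpl; ring.
  - simpl pred; rewrite psi_quot_0, monomial_0; simpl; ring.
  - change (pred (S (S m))) with (S m); change (pred (S m)) with m.
    rewrite monomial_0, psi_quot_S; simpl Nat.eqb.
    rewrite (CInt_ext _ (fun s => phi_quot f m s * Cpow (f s) 2)%C); [ring|].
    intros s Hs; rewrite IH; [simpl; ring | lia |].
    apply (seg_between b x); trivial; lra. }
set (r := fun x => (w x * / (f x * f x))%C).
assert (Hr : forall x, seg b x -> is_derive_C (fun x => y x * / f x)%C x (r x)).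
{ intros x Hx.
  refine (is_derive_C_eq _ _ _ _ (is_derive_Cmult _ _ _ _ _ (Hy x)
    (is_derive_Cinv _ _ _ (Hfn0 x Hx) (Hf x Hx))) _).
  unfold r, w; field; now apply Hfn0. }
assert (Hcr : forall x, seg b x -> continuous (U := C_UniformSpace) r x).
{ intros x Hx; apply (continuous_Cmult (T := R_UniformSpace)); [now apply Hcw|].
  apply (continuous_Cinv (T := R_UniformSpace)).
  - apply Cmult_neq_0; now apply Hfn0.
  - apply (continuous_Cmult (T := R_UniformSpace)); now apply Hcf. }
intros x Hx.
assert (Er : CInt r 0 x = (y x * / f x - y 0%R * / f 0%R)%C).
{ apply (CInt_derive (fun x => y x * / f x)%C); intros s Hs;
    [apply Hr | apply Hcr]; now apply (seg_between b x). }
assert (Hfx := Hfn0 x Hx).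
replace (y x) with (f x * (CInt r 0 x + y 0%R * / f 0%R))%C
  by (rewrite Er; rewrite Hf0; field; auto).
f_equal; rewrite Hf0; unfold y at 1; rewrite transmute_0, monomial_0.
assert (Hin : forall s, Rmin 0 x < s < Rmax 0 x -> seg b s).
{ intros s Hs; apply (seg_between b x); trivial; lra. }
destruct n as [|m]; simpl Nat.eqb; cbv iota.
- rewrite CInt_zero.
  + rewrite phi_quot_0, Cplus_0_l; apply Cinv_r, C1_nz.
  + intros s Hs; unfold r; rewrite Hw by auto; simpl; ring.
- assert (Hn : RtoC (INR (S m)) <> RtoC 0).
  { intros E; apply RtoC_inj in E; revert E; now apply not_0_INR. }
  rewrite phi_quot_S.
  rewrite (CInt_ext (fun s => psi_quot f m s * / Cpow (f s) 2)%C
    (fun s => / RtoC (INR (S m)) * r s)%C).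
  + rewrite CInt_Cmult_l.
    * change (CInt (fun s => r s) 0 x) with (CInt r 0 x); field; exact Hn.
    * apply ex_CInt_continuous; intros s Hs; apply Hcr; now apply (seg_between b x).
  + intros s Hs; unfold r; rewrite Hw by auto.
    simpl pred; replace (Cpow (f s) 2) with (f s * f s)%C by (simpl; ring).
    rewrite <- (Cmult_assoc (RtoC (INR (S m)))), Cmult_assoc, Cinv_l, Cmult_1_l by trivial.
    reflexivity.
Qed.

(** * Transmutation of polynomials *)

Lemma Cinv_nonzero (c : C) : c <> RtoC 0 -> (/ c)%C <> RtoC 0.
Proof.
intros Hc E; apply C1_nz; rewrite <- (Cinv_r c Hc), E; ring.
Qed.

Lemma opT_ext (b : R) (q : R -> C) (h : C) (g k : R -> C) (x : R) :
  (forall s, g s = k s) -> opT b q h g x = opT b q h k x.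
Proof.
intros Hgk; unfold opT; rewrite Hgk; f_equal.
apply CInt_ext; intros s _; now rewrite Hgk.
Qed.

Lemma sum_n_C_ext (u v : nat -> C) (n : nat) :
  (forall k, (k <= n)%nat -> u k = v k) ->
  sum_n (G := C_AbelianGroup) u n = sum_n (G := C_AbelianGroup) v n.
Proof. exact (sum_n_ext_loc (G := C_AbelianGroup) u v n). Qed.

(** The exponents descend as in a binomial expansion. *)
Definition power_sum (N : nat) (c : nat -> C) (Y : nat -> R -> C) (x : R) : C :=
  sum_n (G := C_AbelianGroup) (fun k => c k * Y (N - k)%nat x)%C N.

Lemma opT_polynomial (b : R) (f f1 f2 : R -> C) (q qc : R -> C) :
  0 < b ->
  (forall x, seg b x -> is_derive_C f x (f1 x)) ->
  (forall x, seg b x -> is_derive_C f1 x (f2 x)) ->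
  (forall x, seg b x -> f x <> RtoC 0) -> f 0 = RtoC 1 ->
  (forall x, continuous (U := C_UniformSpace) qc x) ->
  (forall x, seg b x -> qc x = q x) ->
  (forall x, seg b x -> q x = (f2 x / f x)%C) ->
  forall N c x, seg b x ->
    opT b q (f1 0) (power_sum N c monomial) x = (f x * power_sum N c (phi_quot f) x)%C.
Proof.
intros Hb Hf Hf1 Hfn0 Hf0 Hqc Hqcq Hq N c x Hx.
destruct (opT_ode b q qc (f1 0) Hb Hqc Hqcq) as [G [HG [HT Hode]]].
assert (Hpow := transmute_powers b f f1 f2 q G Hb Hf Hf1 Hfn0 Hf0 Hq HG Hode).
assert (Hind : forall M,
  (forall s, continuous (U := C_UniformSpace)
    (fun x => sum_n (G := C_AbelianGroup) (fun k => c k * monomial (N - k)%nat x)%C M) s) /\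
  transmute G (fun x => sum_n (G := C_AbelianGroup) (fun k => c k * monomial (N - k)%nat x)%C M) x
  = (f x * sum_n (G := C_AbelianGroup) (fun k => c k * phi_quot f (N - k)%nat x)%C M)%C).
{ assert (Hterm : forall k s, continuous (U := C_UniformSpace)
     (fun x => c k * monomial (N - k)%nat x)%C s).
  { intros k s; apply (continuous_Cmult (T := R_UniformSpace));
      [apply continuous_const | apply continuous_monomial]. }
  assert (Hone : forall k, transmute G (fun x => c k * monomial (N - k)%nat x)%C x
    = (f x * (c k * phi_quot f (N - k)%nat x))%C).
  { intros k; rewrite transmute_Cmult_l, Hpow by (trivial; apply continuous_monomial).
    ring. }
  induction M as [|M [IHc IH]].
  - split.
    + intros s; apply (continuous_ext (T := R_UniformSpace) (U := C_UniformSpace)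
        (fun x => c 0%nat * monomial (N - 0)%nat x)%C); [|apply Hterm].
      intros y; now rewrite sum_O.
    + rewrite sum_O, <- Hone; unfold transmute, antidiag; rewrite sum_O.
      do 2 f_equal; apply CInt_ext; intros u _; now rewrite sum_O.
  - assert (E : forall y, sum_n (G := C_AbelianGroup) (fun k => c k * monomial (N - k)%nat y)%C (S M)
      = (sum_n (G := C_AbelianGroup) (fun k => c k * monomial (N - k)%nat y)%C M
         + c (S M) * monomial (N - S M)%nat y)%C).
    { intros y; now rewrite sum_Sn. }
    split.
    + intros s; eapply (continuous_ext (T := R_UniformSpace) (U := C_UniformSpace));
        [intros y; symmetry; apply E|].
      now apply (continuous_Cplus (T := R_UniformSpace)).
    + rewrite sum_Sn.
      transitivity (transmute G (fun y =>
        (sum_n (G := C_AbelianGroup) (fun k => c k * monomial (N - k)%nat y)%C M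
         + c (S M) * monomial (N - S M)%nat y)%C) x).
      * unfold transmute, antidiag; rewrite E; do 2 f_equal.
        apply CInt_ext; intros u _; now rewrite E.
      * rewrite transmute_plus, IH, Hone by trivial.
        change plus with Cplus; ring. }
rewrite HT; [apply Hind | apply Hind | exact Hx].
Qed.

(** * The bicomplex binomial theorem *)

Definition even_coef (n : nat) (t : R) (k : nat) : C :=
  if Nat.even k then RtoC (Binomial.C n k * t ^ k) else RtoC 0.

Definition odd_coef (n : nat) (t : R) (k : nat) : C :=
  if Nat.odd k then RtoC (Binomial.C n k * t ^ k) else RtoC 0.

Lemma pow_jB (k : nat) :
  pow_n jB k = mkB (if Nat.even k then RtoC 1 else RtoC 0)
                   (if Nat.odd k then RtoC 1 else RtoC 0).
Proof.
induction k as [|k IH]; [reflexivity|].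
change (pow_n jB (S k)) with (Bmult jB (pow_n jB k)).
rewrite IH, Nat.even_succ, Nat.odd_succ; apply Bicomplex_eq; simpl;
  destruct (Nat.even k), (Nat.odd k); ring.
Qed.

Lemma scB_sum_n (u : nat -> Bicomplex) (n : nat) :
  scB (sum_n u n) = sum_n (G := C_AbelianGroup) (fun k => scB (u k)) n.
Proof.
induction n as [|n IH]; [now rewrite !sum_O|].
rewrite !sum_Sn, <- IH; reflexivity.
Qed.

Lemma vecB_sum_n (u : nat -> Bicomplex) (n : nat) :
  vecB (sum_n u n) = sum_n (G := C_AbelianGroup) (fun k => vecB (u k)) n.
Proof.
induction n as [|n IH]; [now rewrite !sum_O|].
rewrite !sum_Sn, <- IH; reflexivity.
Qed.

Lemma binomial_sum_components (Y : nat -> R -> C) (n : nat) (x t : R) :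
  scB (binomial_sum Y n x t) = power_sum n (even_coef n t) Y x /\
  vecB (binomial_sum Y n x t) = power_sum n (odd_coef n t) Y x.
Proof.
unfold binomial_sum, power_sum; rewrite scB_sum_n, vecB_sum_n.
split; apply sum_n_C_ext; intros k _; rewrite pow_jB; unfold even_coef, odd_coef;
  rewrite RtoC_mult; simpl; destruct (Nat.even k), (Nat.odd k); ring.
Qed.

Lemma sum_n_RtoC (u : nat -> R) (n : nat) :
  sum_n (G := C_AbelianGroup) (fun k => RtoC (u k)) n = RtoC (sum_f_R0 u n).
Proof.
induction n as [|n IH]; [now rewrite sum_O|].
rewrite sum_Sn, IH; simpl; now rewrite RtoC_plus.
Qed.

Lemma power_sum_plus (n : nat) (c d : nat -> C) (Y : nat -> R -> C) (x : R) :
  power_sum n (fun k => c k + d k)%C Y x = (power_sum n c Y x + power_sum n d Y x)%C.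
Proof.
transitivity (sum_n (G := C_AbelianGroup)
  (fun k => plus (c k * Y (n - k)%nat x)%C (d k * Y (n - k)%nat x)%C) n).
- apply sum_n_C_ext; intros k _.
  transitivity (c k * Y (n - k)%nat x + d k * Y (n - k)%nat x)%C; [ring | reflexivity].
- exact (sum_n_plus (G := C_AbelianGroup) _ _ n).
Qed.

Lemma power_sum_Cmult_l (n : nat) (a : C) (c : nat -> C) (Y : nat -> R -> C) (x : R) :
  power_sum n (fun k => a * c k)%C Y x = (a * power_sum n c Y x)%C.
Proof.
transitivity (sum_n (G := C_AbelianGroup) (fun k => a * (c k * Y (n - k)%nat x))%C n).
- apply sum_n_C_ext; intros k _; ring.
- exact (sum_n_mult_l (K := C_Ring) a _ n).
Qed.

(** The evaluations [j = 1] and [j = -1] are ring morphisms to the complex numbers that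
    determine a bicomplex number; they reduce the binomial theorem to two real ones. *)
Lemma pow_zB (x t : R) (n : nat) :
  (scB (pow_n (zB x t) n) + vecB (pow_n (zB x t) n))%C = RtoC ((x + t) ^ n) /\
  (scB (pow_n (zB x t) n) - vecB (pow_n (zB x t) n))%C = RtoC ((x - t) ^ n).
Proof.
induction n as [|n [IH1 IH2]]; [split; simpl; ring|].
change (pow_n (zB x t) (S n)) with (Bmult (zB x t) (pow_n (zB x t) n)).
set (p := pow_n (zB x t) n) in *.
simpl pow; rewrite !RtoC_mult, <- IH1, <- IH2, RtoC_plus, RtoC_minus.
split; simpl; ring.
Qed.

Lemma binomial_zB (x t : R) (n : nat) :
  scB (pow_n (zB x t) n) = power_sum n (even_coef n t) monomial x /\
  vecB (pow_n (zB x t) n) = power_sum n (odd_coef n t) monomial x.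
Proof.
destruct (pow_zB x t n) as [H1 H2].
assert (K1 : (power_sum n (even_coef n t) monomial x + power_sum n (odd_coef n t) monomial x)%C
  = RtoC ((x + t) ^ n)).
{ rewrite <- power_sum_plus, Rplus_comm, Binomial.binomial, <- sum_n_RtoC.
  apply sum_n_C_ext; intros k _; unfold even_coef, odd_coef, monomial.
  rewrite <- Nat.negb_even; destruct (Nat.even k); simpl negb; cbv iota;
    rewrite !RtoC_mult; ring. }
assert (K2 : (power_sum n (even_coef n t) monomial x
   + RtoC (-1) * power_sum n (odd_coef n t) monomial x)%C = RtoC ((x - t) ^ n)).
{ rewrite <- power_sum_Cmult_l, <- power_sum_plus.
  replace (x - t) with (- t + x) by ring.
  rewrite Binomial.binomial, <- sum_n_RtoC.
  apply sum_n_C_ext; intros k _; unfold even_coef, odd_coef, monomial.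
  rewrite <- Nat.negb_even; replace ((- t) ^ k) with ((if Nat.even k then 1 else -1) * t ^ k).
  - destruct (Nat.even k); simpl negb; cbv iota; rewrite !RtoC_mult; ring.
  - replace (- t) with (-1 * t) by ring; rewrite Rpow_mult_distr; f_equal.
    clear; induction k as [|k IH]; [reflexivity|].
    rewrite Nat.even_succ, <- Nat.negb_even; simpl pow; rewrite <- IH.
    destruct (Nat.even k); simpl; ring. }
set (p := pow_n (zB x t) n) in *.
replace (RtoC (-1)) with (- RtoC 1)%C in K2 by now rewrite <- RtoC_opp.
rewrite <- K1 in H1; rewrite <- K2 in H2.
assert (E1 : forall c d e f : C, (c + d = e + f)%C -> (c - d = e + - RtoC 1 * f)%C -> c = e).
{ intros c d e f0 A B.
  replace c with (/ 2 * ((c + d) + (c - d)))%C by field.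
  rewrite A, B; field. }
assert (E2 : forall c d e f : C, (c + d = e + f)%C -> (c - d = e + - RtoC 1 * f)%C -> d = f).
{ intros c d e f0 A B.
  replace d with (/ 2 * ((c + d) - (c - d)))%C by field.
  rewrite A, B; field. }
split; [exact (E1 _ _ _ _ H1 H2) | exact (E2 _ _ _ _ H1 H2)].
Qed.

Lemma phi_quot_parity (f : R -> C) (n k : nat) (x : R) : (k <= n)%nat ->
  phi_quot f (n - k) x = (if xorb (Nat.odd n) (Nat.odd k) then Xpow f (n - k) x
                      else Xtpow f (n - k) x).
Proof.
intros Hk; unfold phi_quot; rewrite Nat.odd_sub by trivial; now destruct xorb.
Qed.

Lemma psi_quot_parity (f : R -> C) (n k : nat) (x : R) : (k <= n)%nat ->
  psi_quot f (n - k) x = (if xorb (Nat.odd n) (Nat.odd k) then Xtpow f (n - k) x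
                      else Xpow f (n - k) x).
Proof.
intros Hk; unfold psi_quot; rewrite Nat.odd_sub by trivial; now destruct xorb.
Qed.

Lemma power_sum_ext (n : nat) (c : nat -> C) (Y Y' : nat -> R -> C) (x : R) :
  (forall k, (k <= n)%nat -> (c k * Y (n - k)%nat x = c k * Y' (n - k)%nat x)%C) ->
  power_sum n c Y x = power_sum n c Y' x.
Proof. intros H; now apply sum_n_C_ext. Qed.

Lemma components_combination (p q : C) (X Z : Bicomplex) :
  scB (plus (mult (BofC p) X) (mult (mult jB (BofC q)) Z))
    = (p * scB X + q * vecB Z)%C /\
  vecB (plus (mult (BofC p) X) (mult (mult jB (BofC q)) Z))
    = (p * vecB X + q * scB Z)%C.
Proof. split; simpl; ring. Qed.

(** The choice between [X] and [Xtilde] in the definition, made on the parity of [n] and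
    on the component of [a], is in each component a choice on the parity of [n - k],
    since an odd [k] moves the term to the other component. *)
Lemma Zstar_components (f : R -> C) (n : nat) (a : Bicomplex) (x t : R) :
  scB (Zstar f n a x t) =
    power_sum n (fun k => scB a * even_coef n t k + vecB a * odd_coef n t k)%C
      (phi_quot f) x /\
  vecB (Zstar f n a x t) =
    power_sum n (fun k => scB a * odd_coef n t k + vecB a * even_coef n t k)%C
      (psi_quot f) x.
Proof.
destruct (binomial_sum_components (Xpow f) n x t) as [X1 X2].
destruct (binomial_sum_components (Xtpow f) n x t) as [Y1 Y2].
rewrite !power_sum_plus, !power_sum_Cmult_l; unfold Zstar.
rewrite (power_sum_ext n (even_coef n t) (phi_quot f) (if Nat.odd n then Xpow f else Xtpow f)),
 (power_sum_ext n (odd_coef n t) (phi_quot f) (if Nat.odd n then Xtpow f else Xpow f)),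
 (power_sum_ext n (odd_coef n t) (psi_quot f) (if Nat.odd n then Xpow f else Xtpow f)),
 (power_sum_ext n (even_coef n t) (psi_quot f) (if Nat.odd n then Xtpow f else Xpow f)).
2, 3, 4, 5: intros k Hk; rewrite ?phi_quot_parity, ?psi_quot_parity by trivial;
  unfold even_coef, odd_coef; rewrite <- ?Nat.negb_odd;
  destruct (Nat.odd n), (Nat.odd k); simpl; ring.
destruct (Nat.odd n); cbv zeta; rewrite <- X1, <- X2, <- Y1, <- Y2;
  apply components_combination.
Qed.

(** * Action on bicomplex powers *)

Lemma Zpow_of_operators (f : R -> C) (T1 T2 : (R -> C) -> R -> C) (n : nat)
  (a : Bicomplex) (x t : R) :
  (forall g k : R -> C, (forall s, g s = k s) -> T1 g x = T1 k x) ->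
  (forall g k : R -> C, (forall s, g s = k s) -> T2 g x = T2 k x) ->
  (forall c, T1 (power_sum n c monomial) x = (f x * power_sum n c (phi_quot f) x)%C) ->
  (forall c, T2 (power_sum n c monomial) x = (/ f x * power_sum n c (psi_quot f) x)%C) ->
  plus (BofC (T1 (fun y => scB (mult a (pow_n (zB y t) n))) x))
       (mult jB (BofC (T2 (fun y => vecB (mult a (pow_n (zB y t) n))) x)))
  = Zpow f n a x t.
Proof.
intros Hext1 Hext2 HT1 HT2; unfold Zpow.
destruct (Zstar_components f n a x t) as [Z1 Z2]; rewrite Z1, Z2, <- HT1, <- HT2.
rewrite (Hext1 _ (power_sum n
  (fun k => scB a * even_coef n t k + vecB a * odd_coef n t k)%C monomial)).
- rewrite (Hext2 _ (power_sum n
    (fun k => scB a * odd_coef n t k + vecB a * even_coef n t k)%C monomial));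
    [reflexivity|].
  intros s; destruct (binomial_zB s t n) as [E1 E2].
  rewrite power_sum_plus, !power_sum_Cmult_l, <- E1, <- E2; reflexivity.
- intros s; destruct (binomial_zB s t n) as [E1 E2].
  rewrite power_sum_plus, !power_sum_Cmult_l, <- E1, <- E2; reflexivity.
Qed.

Theorem proposition5p2
  (b : R) (hb : 0 < b)
  (f f1 f2 : R -> C)
  (hf : is_C2_on_seg b f f1 f2)
  (hf_neq0 : forall x : R, - b <= x <= b -> f x <> RtoC 0)
  (hf0 : f 0 = RtoC 1)
  (x t : R) (hx : - b <= x <= b) (ht : - b <= t <= b)
  (n : nat) (a : Bicomplex) :
  V1 b f f1 f2 (fun x' t' => mult a (pow_n (zB x' t') n)) x t = Zpow f n a x t
  /\
  V2 b f f1 f2 (fun x' t' => mult a (pow_n (zB x' t') n)) x t = Z1pow f n a x t.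
Proof.
destruct hf as [Hf [Hf1 Hf2]].
assert (Hseg : forall y, seg b y <-> - b <= y <= b) by (unfold seg; tauto).
assert (H0 : seg b 0) by (unfold seg; lra).
assert (Hcf1 := is_derive_in_continuous_on _ _ _ Hf1).
assert (Hcf := is_derive_in_continuous_on _ _ _ Hf).
set (F := extend_tangent (- b) b f f1).
set (F1 := extend_tangent (- b) b f1 f2).
assert (HF : forall y, seg b y -> F y = f y) by (intros; now apply extend_tangent_id).
assert (HF1 : forall y, seg b y -> F1 y = f1 y) by (intros; now apply extend_tangent_id).
assert (DF : forall y, seg b y -> is_derive_C F y (F1 y)).
{ intros y Hy; rewrite HF1 by trivial.
  apply (is_derive_extend_tangent (seg b)); auto. }
assert (DF1 : forall y, seg b y -> is_derive_C F1 y (f2 y)).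
{ intros y Hy; apply (is_derive_extend_tangent (seg b)); auto. }
assert (HFn0 : forall y, seg b y -> F y <> RtoC 0).
{ intros y Hy; rewrite HF by trivial; now apply hf_neq0. }
assert (HF0 : F 0 = RtoC 1) by now rewrite HF.
set (c := clamp (- b) b).
assert (Hc : forall y, seg b (c y)) by (intros y; apply clamp_in; lra).
assert (Hcid : forall y, seg b y -> c y = y) by (intros y Hy; now apply clamp_id).
assert (Hclamp : forall g, continuous_on (T := R_UniformSpace) (U := C_UniformSpace)
  (seg b) g -> forall y, continuous (U := C_UniformSpace) (fun y => g (c y)) y).
{ intros g Hg y; apply (continuous_on_clamp (seg b)); trivial; lra. }
assert (Hqf : forall y, continuous (U := C_UniformSpace) (fun y => q_f f f2 (c y)) y).
{ intros y; apply (continuous_Cmult (T := R_UniformSpace) (fun y => f2 (c y))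
    (fun y => / f (c y))%C); [now apply Hclamp|].
  apply (continuous_Cinv (T := R_UniformSpace)); [apply hf_neq0, Hc | now apply Hclamp]. }
assert (Hqi : forall y, continuous (U := C_UniformSpace) (fun y => q_inv f f1 f2 (c y)) y).
{ assert (Hr : forall y, continuous (U := C_UniformSpace) (fun y => f1 (c y) / f (c y))%C y).
  { intros y; apply (continuous_Cmult (T := R_UniformSpace) (fun y => f1 (c y))
      (fun y => / f (c y))%C); [now apply Hclamp|].
    apply (continuous_Cinv (T := R_UniformSpace)); [apply hf_neq0, Hc | now apply Hclamp]. }
  intros y; apply (continuous_ext (T := R_UniformSpace) (U := C_UniformSpace)
    (fun y => - q_f f f2 (c y) + 2 * (f1 (c y) / f (c y) * (f1 (c y) / f (c y))))%C).
  { intros z; unfold q_inv; simpl; ring. }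
  apply (continuous_Cplus (T := R_UniformSpace)).
  - apply (continuous_opp (V := C_R_NormedModule)), Hqf.
  - apply (continuous_Cmult (T := R_UniformSpace)); [apply continuous_const|].
    apply (continuous_Cmult (T := R_UniformSpace)); apply Hr. }
(* The function 1/f solves the equation with potential q_inv, since
   (1/f)'' = - f'' / f^2 + 2 f'^2 / f^3, and has slope - f' 0 at 0: the same lemma
   applies to it. *)
set (G := fun y => (/ F y)%C).
set (G1 := fun y => (- RtoC 1 * F1 y * / (F y * F y))%C).
set (G2 := fun y => (- f2 y / (F y * F y) + 2 * (F1 y * F1 y) / (F y * F y * F y))%C).
assert (DG : forall y, seg b y -> is_derive_C G y (G1 y)).
{ intros y Hy; assert (Hn := HFn0 y Hy).
  refine (is_derive_C_eq _ _ _ _ (is_derive_Cinv F y _ Hn (DF y Hy)) _).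
  unfold G1; field; exact Hn. }
assert (DG1 : forall y, seg b y -> is_derive_C G1 y (G2 y)).
{ intros y Hy; assert (Hn := HFn0 y Hy).
  assert (Hnn : (F y * F y)%C <> RtoC 0) by now apply Cmult_neq_0.
  refine (is_derive_C_eq _ _ _ _ (is_derive_Cmult _ _ _ _ _
    (is_derive_C_const_mult (- RtoC 1)%C _ _ _ (DF1 y Hy))
    (is_derive_Cinv (fun y => F y * F y)%C y _ Hnn
       (is_derive_Cmult _ _ _ _ _ (DF y Hy) (DF y Hy)))) _).
  unfold G2; field; exact Hn. }
assert (HGn0 : forall y, seg b y -> G y <> RtoC 0).
{ intros y Hy; apply Cinv_nonzero; auto. }
assert (HG0 : G 0 = RtoC 1) by (unfold G; rewrite HF0; field).
assert (Eqf : forall y, seg b y -> q_f f f2 y = (f2 y / F y)%C).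
{ intros y Hy; unfold q_f; now rewrite HF. }
assert (Eqi : forall y, seg b y -> q_inv f f1 f2 y = (G2 y / G y)%C).
{ intros y Hy; assert (Hn := HFn0 y Hy).
  unfold q_inv, q_f; rewrite <- (HF y Hy), <- (HF1 y Hy).
  unfold G2, G; simpl; field; exact Hn. }
assert (PF := opT_polynomial b F F1 f2 (q_f f f2) _ hb DF DF1 HFn0 HF0 Hqf
  (fun y Hy => f_equal (q_f f f2) (Hcid y Hy)) Eqf).
assert (PG := opT_polynomial b G G1 G2 (q_inv f f1 f2) _ hb DG DG1 HGn0 HG0 Hqi
  (fun y Hy => f_equal (q_inv f f1 f2) (Hcid y Hy)) Eqi).
rewrite HF1 in PF by exact H0.
replace (G1 0) with (- f1 0%R)%C in PG
  by (unfold G1; rewrite HF0, (HF1 0 H0); field).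
assert (HGf : forall y, seg b y -> G y = (/ f y)%C).
{ intros y Hy; unfold G; now rewrite HF. }
assert (Hinvn0 : forall y, seg b y -> (/ f y)%C <> RtoC 0).
{ intros y Hy; apply Cinv_nonzero; now apply hf_neq0. }
assert (Hext1 : forall q h (g k : R -> C), (forall s, g s = k s) ->
  opT b q h g x = opT b q h k x) by (intros; now apply opT_ext).
assert (Hx : seg b x) by exact hx.
assert (Hsum : forall c (Y Y' : nat -> R -> C), (forall m, Y m x = Y' m x) ->
  power_sum n c Y x = power_sum n c Y' x).
{ intros d Y Y' HY; apply power_sum_ext; intros k _; now rewrite HY. }
assert (SF : forall d, T_f b f f1 f2 (power_sum n d monomial) x
  = (f x * power_sum n d (phi_quot f) x)%C).
{ intros d; unfold T_f; rewrite PF, HF by trivial; f_equal; apply Hsum.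
  intros m; now apply (phi_psi_quot_ext b F f m hb HF x Hx). }
assert (SG : forall d, T_inv b f f1 f2 (power_sum n d monomial) x
  = (/ f x * power_sum n d (psi_quot f) x)%C).
{ intros d; unfold T_inv; rewrite PG, HGf by trivial; f_equal; apply Hsum.
  intros m; rewrite (proj1 (phi_psi_quot_ext b G (fun y => / f y)%C m hb HGf x Hx)).
  apply (phi_psi_quot_inv b f m hb hf_neq0 x Hx). }
split; unfold V1, V2, Z1pow.
- apply Zpow_of_operators; trivial; apply Hext1.
- apply Zpow_of_operators; try apply Hext1.
  (* For 1/f the roles of the two systems are exchanged, and 1 / (1/f) = f. *)
  + intros d; rewrite SG; f_equal; apply Hsum; intros m; symmetry.
    apply (phi_psi_quot_inv b f m hb hf_neq0 x Hx).
  + intros d; rewrite SF; f_equal.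
    * field; now apply hf_neq0.
    * apply Hsum; intros m; symmetry.
      apply (phi_psi_quot_inv b f m hb hf_neq0 x Hx).
Qed.
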